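(* Let $G$ be an infinite transitive graph and let $p<p_c(1/2)$, where $p_c(1/2)$ is the critical parameter of Bernoulli bond percolation on the random $2$-lift $G_{1/2}$. Let $o$ be a vertex of $G_{1/2}$ and let $\mathcal{C}_o$ be the cluster of $o$ in Bernoulli bond percolation of parameter $p$ on $G_{1/2}$. There exist $c,C>0$ such that for all $n\ge 0$, $$\mathbb{P}_{p,1/2}\big[\,|\mathcal{C}_o|\geq n\,\big]\leq Ce^{-cn},$$ where $\mathbb{P}_{p,1/2}$ is the joint law of the random graph $G_{1/2}$ and of the percolation on it.
   Context: All base graphs are non-empty, simple, undirected, connected and locally finite. A graph is transitive if its automorphism group acts transitively on its vertices. Random $2$-lift: let $G=(V,E)$, $q\in[0,1]$, and $V^\star=V\times\{0,1\}$; write $v_0,v_1$ for the two lifts of $v\in V$. Let $(\eta_e)_{e\in E}$ be i.i.d. Bernoulli variables with parameter $q$. For each $e=\{u,v\}\in E$ put in $E(\eta)$ the two edges $\{u_0,v_{\eta_e}\}$ and $\{u_1,v_{1-\eta_e}\}$. The random graph $G_q=(V^\star,E(\eta))$ is the random $2$-lift of $G$. Percolation: conditionally on $\eta$, each edge of $G_q$ is open with probability $p$ and closed otherwise, independently; $G_{p,q}$ is the random graph of open edges, and clusters are its connected components. Let $\Psi(p,q)$ be the probability (over both $\eta$ and the percolation) that $G_{p,q}$ has an infinite cluster. Then $\Psi(p,q)\in\{0,1\}$ and $\Psi$ is non-decreasing in $p$; the critical parameter is $p_c(q)=\sup\{p\in[0,1]:\Psi(p,q)=0\}$. *)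

(* Defs.v *)
From HB Require Import structures.
From mathcomp Require Import all_boot all_order all_algebra finmap.
From mathcomp Require Import all_classical all_reals all_analysis.
From mathcomp Require Import measurable_realfun ring lra.

Set Implicit Arguments.
Unset Strict Implicit.
Unset Printing Implicit Defensive.

Import Order.TTheory GRing.Theory Num.Theory.
Import numFieldNormedType.Exports.

Local Open Scope classical_set_scope.
Local Open Scope ring_scope.

Record sgraph (V : Type) := SGraph {
  adj : rel V ;
  adj_sym : symmetric adj ;
  adj_irr : irreflexive adj }.

Definition component (T : eqType) (e : rel T) (x : T) : set T :=
  [set y | exists2 s : seq T, path e x s & last x s = y].

Definition connected_graph (V : eqType) (G : sgraph V) :=
  forall x y, component (adj G) x y.

Definition locally_finite (V : Type) (G : sgraph V) :=
  forall x, finite_set [set y | adj G x y].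

Definition automorphism (V : Type) (G : sgraph V) (f : V -> V) :=
  bijective f /\ forall x y, adj G (f x) (f y) = adj G x y.

Definition vertex_transitive (V : Type) (G : sgraph V) :=
  forall x y, exists2 f, automorphism G f & f x = y.

Definition is_edge (V : countType) (G : sgraph V) (e : {fset V}) : bool :=
  `[< exists u v, adj G u v /\ e = [fset u; v]%fset >].

Definition edge (V : countType) (G : sgraph V) := {e : {fset V} | is_edge G e}.

Definition cylinders (I : Type) : set (set (I -> bool)) :=
  [set A | exists i b, A = [set w | w i = b]].
Arguments cylinders : clear implicits.

Notation config I := (g_sigma_algebraType (cylinders I)).

(* Independent digits extracted from one uniform variable x on [0, 1]: the n-th
   digit is 1 when the current residue is below s n, and the residue is then
   rescaled so as to be uniform again given the digits found so far. *)
Section digits.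
Context {R : realType}.
Implicit Types (s : nat -> R) (x : R).

Fixpoint residue s x n : R :=
  if n is m.+1 then
    let y := residue s x m in
    if y < s m then y / s m else (y - s m) / (1 - s m)
  else x.

Definition digit s x n : bool := residue s x n < s n.

Lemma measurable_residue s n : measurable_fun [set: R] (residue s ^~ n).
Proof.
elim: n => [|n IHn] //=.
apply: measurable_fun_ifT.
- exact: measurable_fun_ltr.
- by apply: measurable_funM.
- by apply: measurable_funM => //; exact: measurable_funB.
Qed.

Lemma measurable_digit s n : measurable_fun [set: R] (digit s ^~ n).
Proof. by apply: measurable_fun_ltr => //; exact: measurable_residue. Qed.


Definition bernoulli_weight s (b : nat -> bool) n : R :=
  \prod_(k < n) (if b k then s k else 1 - s k).

Lemma bernoulli_weight_ge0 s b n :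
  (forall k, 0 <= s k <= 1) -> 0 <= bernoulli_weight s b n.
Proof.
move=> s01; apply: prodr_ge0 => k _; have := s01 k.
by case: (b k) => /andP[? ?] //; rewrite subr_ge0.
Qed.

Lemma digits_interval s b n : (forall k, 0 <= s k <= 1) ->
  let l := bernoulli_weight s b n in
  exists a : R, [/\ 0 <= a, a + l <= 1 & forall x, 0 <= x < 1 ->
    ((forall k, (k < n)%N -> digit s x k = b k) <-> a <= x < a + l) /\
    (a <= x < a + l -> l * residue s x n = x - a)].
Proof.
move=> s01; elim: n => [|n [a [a0 al1 H]]] /=.
  exists 0; rewrite /bernoulli_weight big_ord0; split => [//||x x01]; first by lra.
  by rewrite add0r; split; [split => // _ k|move=> _; rewrite mul1r subr0].
have l0 := bernoulli_weight_ge0 b n s01.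
have -> : bernoulli_weight s b n.+1 =
    bernoulli_weight s b n * (if b n then s n else 1 - s n).
  by rewrite /bernoulli_weight big_ord_recr.
move: (bernoulli_weight s b n) => l in al1 H l0 *.
have /andP[t0 t1] := s01 n.
have lt0 : 0 <= l * s n by rewrite mulr_ge0.
have ltl : l * s n <= l by rewrite ler_piMr.
have split_digits x : (forall k, (k < n.+1)%N -> digit s x k = b k) <->
    (forall k, (k < n)%N -> digit s x k = b k) /\ digit s x n = b n.
  split=> [h|[h hn] k]; first by split => [k kn|]; apply: h => //; exact: ltnW.
  by rewrite ltnS leq_eqVlt => /predU1P[->//|]; exact: h.
have digitE x : 0 <= x < 1 -> a <= x < a + l ->
    digit s x n = (x < a + l * s n).
  move=> x01 xal; have [_ /(_ xal) E] := H _ x01.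
  have lpos : 0 < l by move: xal => /andP[]; lra.
  by rewrite /digit -(ltr_pM2l lpos) E ltrBlDl.
case bn : (b n).
- exists a; split => [//||x x01]; first by lra.
  rewrite split_digits bn; have [H1 H2] := H _ x01; split.
    split=> [[/H1 xal]|xal]; first by rewrite digitE //; move: xal => /andP[-> _].
    have xal' : a <= x < a + l by move: xal => /andP[-> /=]; lra.
    by split; [exact/H1|rewrite digitE //; case/andP: xal].
  move=> xal; have xal' : a <= x < a + l by move: xal => /andP[-> /=]; lra.
  have := digitE _ x01 xal'; rewrite /digit => ->.
  have -> : (x < a + l * s n) by case/andP: xal.
  have sn0 : s n != 0.
    by apply/eqP => e; move: xal; rewrite e mulr0 => /andP[? ?]; lra.
  by rewrite -(H2 xal'); field.
- have E : l * (1 - s n) = l - l * s n by ring.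
  exists (a + l * s n); rewrite E; split => [||x x01]; [by lra|by lra|].
  rewrite split_digits bn; have [H1 H2] := H _ x01; split.
    split=> [[/H1 xal]|xal].
      by rewrite digitE // => /negbT; rewrite -leNgt => ->; case/andP: xal; lra.
    have xal' : a <= x < a + l by move: xal => /andP[? ?]; apply/andP; lra.
    split; [exact/H1|rewrite digitE //]; apply/negbTE; rewrite -leNgt.
    by case/andP: xal.
  move=> xal; have xal' : a <= x < a + l by move: xal => /andP[? ?]; apply/andP; lra.
  have := digitE _ x01 xal'; rewrite /digit => ->.
  have -> : (x < a + l * s n) = false.
    by apply/negbTE; rewrite -leNgt; case/andP: xal.
  have sn0 : 1 - s n != 0.
    apply/eqP => e; move: E xal; rewrite e mulr0 => E /andP[? ?]; lra.
  by rewrite opprD addrA -(H2 xal'); field.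
Qed.

Lemma uniform01E (A : set R) : measurable A ->
  uniform_prob (@ltr01 R) A = lebesgue_measure (A `&` `[0, 1]).
Proof.
move=> mA; rewrite /uniform_prob integral_uniform_pdf.
rewrite (eq_integral (cst 1%E)) => [|x].
  by rewrite integral_cst ?mul1e //; exact: measurableI.
rewrite inE => -[_]; rewrite /= in_itv /= => x01.
by rewrite /uniform_pdf x01 subr0 invr1.
Qed.

Lemma measurable_digit_eq s n c : measurable [set x | digit s x n = c].
Proof.
rewrite (_ : [set _ | _] = [set: R] `&` (digit s ^~ n) @^-1` [set c]).
  exact: measurable_digit.
by rewrite setTI.
Qed.

Lemma measurable_digits_eq s (m b : nat -> bool) n :
  measurable [set x | forall k, (k < n)%N -> m k -> digit s x k = b k].
Proof.
elim: n => [|n IHn].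
  by rewrite (_ : [set _ | _] = setT) //; apply/seteqP; split.
rewrite (_ : [set _ | _] =
  [set x | forall k, (k < n)%N -> m k -> digit s x k = b k] `&`
  (if m n then [set x | digit s x n = b n] else setT)).
  by apply: measurableI => //; case: ifP => // _; exact: measurable_digit_eq.
apply/seteqP; split => x /=.
  move=> h; split=> [k kn|]; first by apply: h; exact: ltnW.
  by case: ifP => // mn; exact: h.
move=> [h hn] k; rewrite ltnS leq_eqVlt => /predU1P[->|]; last exact: h.
by move: hn; case: ifP.
Qed.

Lemma uniform_digits_prefix s b n : (forall k, 0 <= s k <= 1) ->
  uniform_prob (@ltr01 R)
    [set x | forall k, (k < n)%N -> true -> digit s x k = b k] =
  (bernoulli_weight s b n)%:E.
Proof.
move=> s01; rewrite uniform01E; last exact: (measurable_digits_eq s xpredT b n).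
set A := [set x | _].
have mA : measurable A by exact: (measurable_digits_eq s xpredT b n).
have [a [a0 al1 H]] := digits_interval b n s01.
have l0 := bernoulli_weight_ge0 b n s01.
move: (bernoulli_weight s b n) => l in a0 al1 H l0 *.
have lE : lebesgue_measure (`[a, a + l[ : set R) = l%:E.
  rewrite lebesgue_measure_itv /= lte_fin ltrDl.
  by case: ltP => [_|l0']; [rewrite -EFinB addrC addKr|congr EFin; lra].
apply/eqP; rewrite eq_le -lE; apply/andP; split.
  have -> : lebesgue_measure (`[a, a + l[ : set R) =
      lebesgue_measure (`[a, a + l[ `|` [set 1] : set R).
    by rewrite measureU0 //; exact: lebesgue_measure_set1.
  apply: le_measure; rewrite ?inE.
  - exact: measurableI.
  - exact: measurableU.
  move=> x [Ax]; rewrite /= in_itv /= => /andP[x0].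
  rewrite le_eqVlt => /predU1P[->|x1]; [by right|left].
  rewrite /= in_itv /=; have x01 : 0 <= x < 1 by rewrite x0.
  by apply/(proj1 (H _ x01)) => k kn; exact: Ax.
apply: le_measure; rewrite ?inE => //; first exact: measurableI.
move=> x; rewrite /= !in_itv /= => xal.
have x01 : 0 <= x < 1 by case/andP: xal => ? ?; apply/andP; lra.
split; last by case/andP: x01 => -> /ltW.
by move=> k kn _; move/(proj1 (H _ x01)): xal; apply.
Qed.

Lemma uniform_digits s (m b : nat -> bool) n : (forall k, 0 <= s k <= 1) ->
  uniform_prob (@ltr01 R)
    [set x | forall k, (k < n)%N -> m k -> digit s x k = b k] =
  (\prod_(k < n | m k) (if b k then s k else 1 - s k))%:E.
Proof.
move=> s01.
pose mi i k := (k < i)%N || m k.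
suff gen d : forall b' i, (n - i <= d)%N ->
  uniform_prob (@ltr01 R)
    [set x | forall k, (k < n)%N -> mi i k -> digit s x k = b' k] =
  (\prod_(k < n | mi i k) (if b' k then s k else 1 - s k))%:E.
  have := gen n b 0%N; rewrite subn0 => /(_ (leqnn _)) <-.
  by [].
elim: d => [|d IHd] b' i.
  rewrite leqn0 subn_eq0 => ni.
  have miT k : (k < n)%N -> mi i k by move=> kn; rewrite /mi (leq_trans kn ni).
  rewrite (eq_bigl xpredT) => [|k]; last by rewrite miT.
  rewrite -[RHS](uniform_digits_prefix b' n s01); congr (uniform_prob _ _).
  by apply/seteqP; split=> x h k kn _; apply: h => //; exact: miT.
have [ni|ilt ni] := leqP n i; first by move=> _; apply: IHd; rewrite (eqP ni).
have nid : (n - i.+1 <= d)%N by rewrite subnS; move: ni; case: (n - i)%N.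
have miS k : mi i.+1 k = (k == i) || mi i k.
  by rewrite /mi ltnS leq_eqVlt orbA.
have [Mi|nMi] := boolP (m i).
  have E : mi i.+1 =1 mi i.
    by move=> k; rewrite miS; case: eqP => // ->; rewrite /mi Mi orbT.
  have := IHd b' _ nid; under eq_bigl do rewrite E.
  move=> <-; congr (uniform_prob _ _).
  by apply/seteqP; split=> x h k kn mk; apply: h => //; move: mk; rewrite E.
have nmii : ~~ mi i i by rewrite /mi ltnn.
pose bc c k := if k == i then c else b' k.
have mS c : [set x | forall k, (k < n)%N -> mi i.+1 k -> digit s x k = bc c k] =
    [set x | forall k, (k < n)%N -> mi i k -> digit s x k = b' k] `&`
    [set x | digit s x i = c].
  apply/seteqP; split=> x /=.
    move=> h; split=> [k kn mk|]; last first.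
      by rewrite h ?miS ?eqxx // /bc eqxx.
    rewrite h ?miS ?mk ?orbT // /bc; case: eqP mk => // ->.
    by rewrite (negbTE nmii).
  move=> [h hi] k kn; rewrite miS /bc; case: eqP => [->//|_ /=]; exact: h.
pose D := [set x | forall k, (k < n)%N -> mi i k -> digit s x k = b' k].
have DE : D = (D `&` [set x | digit s x i = true]) `|`
              (D `&` [set x | digit s x i = false]).
  rewrite -setIUr (_ : _ `|` _ = setT) ?setIT //.
  by apply/seteqP; split=> x //= _; case: digit; [left|right].
have mD : measurable D by exact: measurable_digits_eq.
rewrite -/D DE measureU; first last.
- by apply/seteqP; split=> x //= [[_ ->] [_]].
- by apply: measurableI => //; exact: measurable_digit_eq.
- by apply: measurableI => //; exact: measurable_digit_eq.
have IH c := IHd (bc c) _ nid.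
transitivity ((\prod_(k < n | mi i.+1 k) (if bc true k then s k else 1 - s k))%:E +
  (\prod_(k < n | mi i.+1 k) (if bc false k then s k else 1 - s k))%:E)%E.
  by rewrite -2!IH !mS.
rewrite -EFinD; congr EFin.
have prodE c : \prod_(k < n | mi i.+1 k) (if bc c k then s k else 1 - s k) =
  (if c then s i else 1 - s i) *
  \prod_(k < n | mi i k) (if b' k then s k else 1 - s k).
  rewrite (bigD1 (Ordinal ilt)) /= ?miS ?eqxx // /bc eqxx; congr (_ * _).
  apply: eq_big => k.
    rewrite miS -val_eqE /=; case: eqP => [->|] //=; last by rewrite andbT.
    by rewrite (negbTE nmii).
  by move=> /andP[_]; rewrite -val_eqE /= => /negbTE ->.
by rewrite !prodE -mulrDl addrC subrK mul1r.
Qed.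

End digits.

Section bernoulli_product.
Context {R : realType} {I : countType}.
Variable p : I -> R.

Definition param (n : nat) : R := oapp p 0 (pickle_inv n).

Definition digit_config (x : measurableTypeR R) : config I :=
  fun i => digit param x (choice.pickle i).

Lemma measurable_digit_config : measurable_fun [set: measurableTypeR R] digit_config.
Proof.
apply: (@measurability _ _ (measurableTypeR R) (config I) setT digit_config
  (cylinders I)) => //.
move=> _ [_ [i [b ->]] <-].
rewrite [X in measurable X](_ : _ =
  [set: R] `&` (digit param ^~ (choice.pickle i)) @^-1` [set b]) //.
exact: measurable_digit.
Qed.

HB.instance Definition _ :=
  isMeasurableFun.Build _ _ (measurableTypeR R) (config I)
    digit_config measurable_digit_config.

(* The law of independent Bernoulli variables (w i)_i of parameters (p i)_i;
   see bernoulli_productE. *)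
Definition bernoulli_product : probability (config I) R :=
  distribution (uniform_prob (@ltr01 R)) digit_config.

End bernoulli_product.

Lemma bernoulli_productE (R : realType) (I : countType) (p : I -> R)
    (J : seq I) (b : I -> bool) :
  (forall i, 0 <= p i <= 1) -> uniq J ->
  bernoulli_product p [set w | forall i, i \in J -> w i = b i] =
  (\prod_(i <- J) (if b i then p i else 1 - p i))%:E.
Proof.
move=> p01 uJ.
pose m n := oapp (mem J) false (pickle_inv n : option I).
pose b' n := oapp b false (pickle_inv n).
pose N := \max_(i <- J) (choice.pickle i).+1.
have JN i : i \in J -> (choice.pickle i < N)%N.
  by move=> iJ; rewrite /N; exact: (@leq_bigmax_seq _ _ xpredT (fun i => (choice.pickle i).+1)).
have s01 k : 0 <= param p k <= 1.
  by rewrite /param; case: (pickle_inv k) => //= ; rewrite lexx ler01.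
transitivity (uniform_prob (@ltr01 R)
    [set x | forall k, (k < N)%N -> m k -> digit (param p) x k = b' k]).
  rewrite /bernoulli_product /distribution /pushforward /=.
  congr (uniform_prob _ _); apply/seteqP; split=> x /= h.
    move=> k kN; rewrite /m /b'.
    case E : (pickle_inv k) => [i|] //= iJ.
    by have := @pickle_invK I k; rewrite E /= => <-; exact: h.
  move=> i iJ; rewrite /digit_config h ?JN // /m /b' pickleK_inv //.
rewrite (uniform_digits m b' N s01); congr EFin.
rewrite -(big_mkord m (fun k => if b' k then param p k else 1 - param p k)).
rewrite -big_filter (perm_big (map choice.pickle J)) /=.
  by rewrite big_map; apply: eq_bigr => i _; rewrite /b' /param pickleK_inv.
apply: uniq_perm; first by rewrite filter_uniq // iota_uniq.
  by rewrite map_inj_uniq //; exact: pcan_inj pickleK_inv.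
move=> k; rewrite mem_filter mem_index_iota leq0n /=.
apply/andP/mapP => [[]|[i iJ ->]]; last by rewrite /m pickleK_inv JN.
rewrite /m; case E : (pickle_inv k) => [i|] //= iJ _; exists i => //.
by have := @pickle_invK I k; rewrite E.
Qed.

(* Connected locally finite graphs are countable, so that taking the vertices in
   a countType is no restriction. *)
Section percolation.
Context {V : countType} (G : sgraph V).

(* The vertices v_0, v_1 are (v, false), (v, true). *)

(* Any edge of a 2-lift of G is an edge of this graph. *)
Program Definition lift_pairs : sgraph (V * bool)%type :=
  {| adj := fun x y => adj G x.1 y.1 |}.
Next Obligation. by move=> x y; rewrite adj_sym. Qed.
Next Obligation. by move=> x; rewrite adj_irr. Qed.

(* E(eta); the definition is symmetric under swapping u and v. *)
Definition lift_edges (eta : edge G -> bool) : set {fset V * bool} :=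
  [set f | exists (e : edge G) u v, val e = [fset u; v]%fset /\
    (f = [fset (u, false); (v, eta e)]%fset \/
     f = [fset (u, true); (v, ~~ eta e)]%fset)].

(* The coordinates inl e are the variables eta_e, and the coordinate inr f is
   the state of f, which is only used when f belongs to E(eta): given eta, the
   states of the edges of the 2-lift are thus independent. *)
Definition percolation_config := config (edge G + edge lift_pairs)%type.

Definition percolation (R : realType) (p q : R) :
    probability percolation_config R :=
  bernoulli_product (fun i : edge G + edge lift_pairs =>
    if i is inl _ then q else p).

Definition open_adj (w : percolation_config) : rel (V * bool) := fun x y =>
  `[< exists f : edge lift_pairs, [/\ val f = [fset x; y]%fset,
        lift_edges (fun e => w (inl e)) (val f) & w (inr f)] >].

Definition open_cluster (w : percolation_config) (x : V * bool) : set (V * bool) :=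
  component (open_adj w) x.

Definition Psi (R : realType) (p q : R) : \bar R :=
  percolation p q [set w | exists x, infinite_set (open_cluster w x)].

Definition p_c (R : realType) (q : R) : R :=
  sup [set p : R | 0 <= p <= 1 /\ Psi p q = 0%E].

End percolation.

(* Main.v *)
From HB Require Import structures.
Require Import Defs.
From mathcomp Require Import all_boot all_order all_algebra finmap.
From mathcomp Require Import all_classical all_reals all_analysis.
From mathcomp Require Import ring lra.

Set Implicit Arguments.
Unset Strict Implicit.
Unset Printing Implicit Defensive.

Import Order.TTheory GRing.Theory Num.Theory.
Import numFieldNormedType.Exports.

Local Open Scope classical_set_scope.
Local Open Scope ring_scope.

(* Write theta_n(t) for the probability that the cluster of o has at least n
   vertices at parameter t, and let each vertex be green independently with
   probability 1/n. The decision tree exploring the clusters of the green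
   vertices decides whether o is connected to a green vertex, and it reveals an
   edge with probability O(m), where m = (theta_1 + ... + theta_n) / n, because
   theta_n does not depend on o. The twists eta_e are queried along with the
   edges; as eta_e is irrelevant once the lifts of e are closed, its influence is
   controlled by those of the lifts. The OSSS inequality and Russo's formula thus
   give theta_n (1/2 - m) <= C m theta_n'. If theta_n -> 0 at some b > p, these
   inequalities integrate to the exponential decay of theta_n at p. *)

(** * Averages of functions of independent bits and the OSSS inequality *)

(** The event that the cluster of o is large increases with the states of the lifted edges but is
    not monotone in the twists, and a lift with fixed twists need not be homogeneous. Hence
    everything is averaged over the twists: only the parameter of the states is differentiated, and
    the twists enter through their influences alone. OSSS is used in its two-function form: the tree
    answers whether o meets a green vertex, while the influences are those of the event that the
    cluster of o has n vertices. The density 1/n ties the two together: a cluster with n vertices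
    misses the green vertices with probability at most 1/2, whereas a cluster K meets them with
    probability at most min(|K|, n)/n, whose mean is m. This yields both the factor 1/2 - m and the
    bound on revealments. The green marks are averaged outside OSSS, so they carry no influence of
    their own. All these events depend on finitely many coordinates: expectations are iterated
    two-point averages, and the product measure comes in only at the end. *)

Section update.
Context {I : eqType}.
Implicit Types (i j : I) (w : I -> bool) (b : bool).

Definition upd w i b : I -> bool := fun j => if j == i then b else w j.

Lemma upd_id w i : upd w i (w i) = w.
Proof. by apply/funext => j; rewrite /upd; case: eqP => // ->. Qed.

Lemma upd_eq w i b : upd w i b i = b.
Proof. by rewrite /upd eqxx. Qed.

Lemma upd_neq w i j b : j != i -> upd w i b j = w j.
Proof. by rewrite /upd => /negbTE ->. Qed.

Lemma upd_upd w i b c : upd (upd w i b) i c = upd w i c.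
Proof. by apply/funext => j; rewrite /upd; case: eqP. Qed.

Lemma upd_case {T : Type} (f : (I -> bool) -> T) w i :
  f w = if w i then f (upd w i true) else f (upd w i false).
Proof. by case wi : (w i); rewrite -wi upd_id. Qed.

Lemma updC w i j b c : i != j -> upd (upd w i b) j c = upd (upd w j c) i b.
Proof.
move=> ij; apply/funext => k; rewrite /upd.
by case: eqP => [->|//]; rewrite eq_sym (negbTE ij).
Qed.

Definition depends_on {T : Type} (s : seq I) (f : (I -> bool) -> T) :=
  forall w w', {in s, w =1 w'} -> f w = f w'.

Lemma depends_onW {T : Type} (s t : seq I) (f : (I -> bool) -> T) :
  {subset s <= t} -> depends_on s f -> depends_on t f.
Proof. by move=> st df w w' e; apply: df => i /st; exact: e. Qed.

End update.

Section averaging.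
Context {R : realType} {I : eqType}.
Variable p : I -> R.
Implicit Types (i j : I) (w : I -> bool) (f g : (I -> bool) -> R) (s : seq I).

Definition avg i f : (I -> bool) -> R :=
  fun w => p i * f (upd w i true) + (1 - p i) * f (upd w i false).

(** The result is still a function of the configuration, read outside [s], which is what inductions
    on [s] need. A repetition in [s] is harmless because [avg i] is idempotent. *)
Definition Ex s f : (I -> bool) -> R := foldr avg f s.

Lemma avg_upd i f w b : avg i f (upd w i b) = avg i f w.
Proof. by rewrite /avg !upd_upd. Qed.

Lemma avgC i j f : avg i (avg j f) = avg j (avg i f).
Proof.
have [->//|ij] := eqVneq i j.
apply/funext => w; rewrite /avg ![upd (upd w i _) j _]updC //.
by ring.
Qed.

Lemma avg_indep i f : (forall w b, f (upd w i b) = f w) -> avg i f = f.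
Proof. by move=> h; apply/funext => w; rewrite /avg !h; ring. Qed.

Lemma avg_avg i f : avg i (avg i f) = avg i f.
Proof. by apply: avg_indep => w b; rewrite avg_upd. Qed.

Lemma avg_Ex i s f : avg i (Ex s f) = Ex s (avg i f).
Proof. by elim: s => //= j s <-; rewrite avgC. Qed.

Lemma Ex_avg s i f : i \in s -> Ex s (avg i f) = Ex s f.
Proof.
elim: s => //= j s IH; rewrite inE => /predU1P[->|/IH -> //].
by rewrite -avg_Ex avg_avg.
Qed.

Lemma ExD s f g w : Ex s (fun w => f w + g w) w = Ex s f w + Ex s g w.
Proof. by elim: s w => //= i s IH w; rewrite /avg !IH; ring. Qed.

Lemma ExZ s c f w : Ex s (fun w => c * f w) w = c * Ex s f w.
Proof. by elim: s w => //= i s IH w; rewrite /avg !IH; ring. Qed.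

Lemma Ex_cst s c w : Ex s (fun=> c) w = c.
Proof. by elim: s w => //= i s IH w; rewrite /avg !IH; ring. Qed.

Lemma ExN s f w : Ex s (fun w => - f w) w = - Ex s f w.
Proof. by elim: s w => //= i s IH w; rewrite /avg !IH; ring. Qed.

Lemma ExB s f g w : Ex s (fun w => f w - g w) w = Ex s f w - Ex s g w.
Proof. by rewrite (ExD s f (fun w => - g w)) ExN. Qed.

Lemma Ex_sum (J : Type) (r : seq J) (F : J -> (I -> bool) -> R) s w :
  Ex s (fun w => \sum_(k <- r) F k w) w = \sum_(k <- r) Ex s (F k) w.
Proof.
elim: r => [|k r IH].
  rewrite big_nil -[RHS](Ex_cst s 0 w); congr (Ex _ _ _).
  by apply/funext => u; rewrite big_nil.
rewrite big_cons -IH -ExD; congr (Ex _ _ _).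
by apply/funext => u; rewrite big_cons.
Qed.

Lemma depends_avg i s f : depends_on (i :: s) f -> depends_on s (avg i f).
Proof.
move=> df w w' e; rewrite /avg.
have H b : f (upd w i b) = f (upd w' i b).
  apply: df => j; rewrite inE /upd; case: eqP => //= _; exact: e.
by rewrite !H.
Qed.

Lemma depends_Ex s t f : depends_on (s ++ t) f -> depends_on t (Ex s f).
Proof.
move=> df; elim: s f df => //= i s IH f df.
by rewrite avg_Ex; apply: IH; apply: depends_avg.
Qed.

Lemma Ex_base s f w w' : depends_on s f -> Ex s f w = Ex s f w'.
Proof.
by move=> df; apply: (@depends_Ex s [::]) => //; rewrite cats0.
Qed.

Lemma depends_upd s f w i b : depends_on s f -> i \notin s -> f (upd w i b) = f w.
Proof.
move=> df si; apply: df => j sj; rewrite upd_neq //.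
by apply: contraNneq si => <-.
Qed.

Lemma Ex_indep t f : (forall i, i \in t -> forall w b, f (upd w i b) = f w) -> Ex t f = f.
Proof.
elim: t => //= i t IH h; rewrite IH => [|j jt]; last by apply: h; rewrite inE jt orbT.
by apply: avg_indep; apply: h; rewrite inE eqxx.
Qed.

Lemma Ex_cat s t f : Ex (s ++ t) f = Ex s (Ex t f).
Proof. by rewrite /Ex foldr_cat. Qed.

Lemma Ex_perm s t f : perm_eq s t -> Ex s f = Ex t f.
Proof.
elim: s t => [|i s IH] t; first by move=> /perm_size /esym /size0nil ->.
move=> st; have it : i \in t by rewrite -(perm_mem st) inE eqxx.
case/splitPr: it st => t1 t2 st.
have {}st : perm_eq s (t1 ++ t2).
  by rewrite -(perm_cons i) (perm_trans st) // perm_catC /= perm_cons perm_catC.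
by rewrite /= (IH _ st) Ex_cat avg_Ex [RHS]Ex_cat /=.
Qed.

Lemma Ex_undup s f : Ex (undup s) f = Ex s f.
Proof.
elim: s => //= i s IH; case: ifP => [si|_ /=]; last by rewrite IH.
by rewrite IH avg_Ex Ex_avg.
Qed.

(** Once both lists are freed of repetitions, the coordinates of [t] outside [s] do not affect [f].
    Events with different supports can thus be averaged over one common list. *)
Lemma Ex_superset s t f : depends_on s f -> {subset s <= t} -> Ex t f = Ex s f.
Proof.
move=> df st; rewrite -(Ex_undup t) -(Ex_undup s).
pose u := [seq i <- undup t | i \notin s].
have E : perm_eq (undup t) (undup s ++ u).
  rewrite -(perm_filterC (mem s) (undup t)) perm_cat //.
  apply: uniq_perm; rewrite ?filter_uniq ?undup_uniq // => i.
  rewrite mem_filter !mem_undup; case si : (i \in s); rewrite ?andbF //.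
    by rewrite inE si st.
  by rewrite inE si.
rewrite (Ex_perm _ E) Ex_cat (@Ex_indep u) // => i; rewrite mem_filter => /andP[si _] w b.
exact: depends_upd df si.
Qed.

Hypothesis p01 : forall i, 0 <= p i <= 1.

Lemma ler_avg i f g w : (forall w, f w <= g w) -> avg i f w <= avg i g w.
Proof.
move=> fg; have /andP[p0 p1] := p01 i.
by rewrite /avg lerD // ler_wpM2l // subr_ge0.
Qed.

Lemma ler_Ex s f g w : (forall w, f w <= g w) -> Ex s f w <= Ex s g w.
Proof. by move=> fg; elim: s w => //= i s IH w; exact: ler_avg. Qed.

Lemma Ex_ge0 s f w : (forall w, 0 <= f w) -> 0 <= Ex s f w.
Proof. by move=> f0; rewrite -[leLHS](Ex_cst s 0 w); exact: ler_Ex. Qed.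

Lemma Ex_le1 s f w : (forall w, f w <= 1) -> Ex s f w <= 1.
Proof. by move=> f0; rewrite -[leRHS](Ex_cst s 1 w); exact: ler_Ex. Qed.

End averaging.

Lemma Ex_Fubini (R : realType) (I J : eqType) (p : I -> R) (q : J -> R)
    (s : seq I) (t : seq J) (h : (J -> bool) -> (I -> bool) -> R) v w :
  Ex q t (fun v => Ex p s (h v) w) v = Ex p s (fun w => Ex q t (h^~ w) v) w.
Proof.
elim: t v => //= j t IH v; rewrite /avg !IH -!ExZ -ExD //.
Qed.

Lemma Ex_relabel (R : realType) (I J : eqType) (p : I -> R) (q : J -> R) (tau : I -> J)
    (s : seq I) (f : (I -> bool) -> R) (w : J -> bool) :
  injective tau -> (forall i, q (tau i) = p i) ->
  Ex q (map tau s) (fun w => f (w \o tau)) w = Ex p s f (w \o tau).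
Proof.
move=> itau qp; elim: s w => //= i s IH w; rewrite /avg !IH qp.
have E b : upd w (tau i) b \o tau = upd (w \o tau) i b.
  by apply/funext => k; rewrite /upd /= inj_eq.
by rewrite !E.
Qed.

(* Along a branch, a coordinate may be queried several times. *)
Inductive dtree (I : Type) :=
  | Leaf of bool
  | Node of I & dtree I & dtree I.
Arguments Leaf {I}.

Section OSSS.
Context {R : realType} {I : eqType}.
Variable p : I -> R.
Hypothesis p01 : forall i, 0 <= p i <= 1.
Implicit Types (i j : I) (w : I -> bool) (f g : (I -> bool) -> R) (s : seq I).
Implicit Types (T : dtree I).

Fixpoint outcome T w : bool :=
  match T with
  | Leaf b => b
  | Node i T1 T0 => if w i then outcome T1 w else outcome T0 w
  end.

Fixpoint queries T w : seq I :=
  match T with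
  | Leaf _ => [::]
  | Node i T1 T0 => i :: (if w i then queries T1 w else queries T0 w)
  end.

(** The coordinate read at the root may be read again lower down. Hard-wiring its answer removes
    these later queries, so the restricted tree is independent of [i]. *)
Fixpoint restr i b T : dtree I :=
  match T with
  | Leaf c => Leaf c
  | Node j T1 T0 =>
    if j == i then restr i b (if b then T1 else T0)
    else Node j (restr i b T1) (restr i b T0)
  end.

Fixpoint depth T : nat :=
  if T is Node _ T1 T0 then (maxn (depth T1) (depth T0)).+1 else 0.

Lemma depth_restr i b T : (depth (restr i b T) <= depth T)%N.
Proof.
elim: T => //= j T1 IH1 T0 IH0; case: eqP => _ /=.
  by case: b IH1 IH0 => IH1 IH0; rewrite ltnW // ltnS leq_max ?IH1 ?IH0 ?orbT.
by rewrite ltnS geq_max !leq_max IH1 IH0 orbT.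
Qed.

Lemma outcome_restr i b T w : outcome (restr i b T) w = outcome T (upd w i b).
Proof.
elim: T => //= j T1 IH1 T0 IH0; case: eqP => [->|/eqP ji] /=.
  by rewrite upd_eq; case: b IH1 IH0.
by rewrite upd_neq // IH1 IH0.
Qed.

Lemma queries_restr i b T w j :
  (j \in queries (restr i b T) w) = (j != i) && (j \in queries T (upd w i b)).
Proof.
elim: T => [c|k T1 IH1 T0 IH0] /=; first by rewrite andbF.
case: (eqVneq k i) => [->|ki] /=.
  rewrite upd_eq inE; case: b IH1 IH0 => IH1 IH0; rewrite ?IH1 ?IH0;
    by case: (eqVneq j i).
rewrite upd_neq // !inE; case: (eqVneq j k) => [->|jk] /=; first by rewrite ki.
by case: (w k); rewrite ?IH1 ?IH0.
Qed.

(** For [i] in [s] this is [2 p_i (1 - p_i)] times the mean gap between the two values of [f] at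
    [i], which is also the mean change of [f] when [i] is resampled. *)
Definition influence s i f w := Ex p s (fun w => `|f w - avg p i f w|) w.

(* Resampling the root coordinate i costs at most the influence of i; f with i
   averaged out is then compared with the two restricted trees. *)
Lemma OSSS s f T w :
  (forall w, {subset queries T w <= s}) ->
  Ex p s (fun w => f w * (outcome T w)%:R) w -
    Ex p s f w * Ex p s (fun w => (outcome T w)%:R) w <=
  \sum_(j <- undup s) Ex p s (fun w => (j \in queries T w)%:R) w * influence s j f w.
Proof.
(* Induction on the depth rather than on the tree, as the restricted trees are not subtrees of [T].
   At a leaf the answer is constant and the covariance vanishes. *)
have [d] := ubnP (depth T); elim: d T => // d IH [c|i T1 T0] dT qs.
  rewrite /= Ex_cst; under eq_fun do rewrite mulrC; rewrite ExZ mulrC subrr.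
  apply: sumr_ge0 => j _; apply: mulr_ge0; first exact: Ex_ge0.
  exact: Ex_ge0.
set T := Node i T1 T0 in dT qs *.
have si : i \in s by apply: (qs w); rewrite inE eqxx.
have p_i := p01 i.
pose T' b := restr i b T.
have dT' b : (depth (T' b) < d)%N.
  apply: leq_ltn_trans (_ : (maxn (depth T1) (depth T0) < d)%N) => //.
  rewrite /T' /= eqxx; case: b; rewrite (leq_trans (depth_restr _ _ _)) //.
    by rewrite leq_maxl.
  by rewrite leq_maxr.
have qT' b v : {subset queries (T' b) v <= s}.
  by move=> j; rewrite queries_restr => /andP[_ /qs].
have {}IH b := IH (T' b) (dT' b) (qT' b).
pose o T w : R := (outcome T w)%:R.
have Esplit (h : bool -> (I -> bool) -> R) (k : (I -> bool) -> R) :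
    (forall v b, k (upd v i b) = h b v) ->
    Ex p s k w = p i * Ex p s (h true) w + (1 - p i) * Ex p s (h false) w.
  move=> kh; rewrite -(Ex_avg p k si) -!ExZ -ExD; congr (Ex _ _ _ _).
  by apply/funext => v; rewrite /avg !kh.
have Eo : Ex p s (o T) w = p i * Ex p s (o (T' true)) w + (1 - p i) * Ex p s (o (T' false)) w.
  by apply: (Esplit (fun b => o (T' b))) => v b; rewrite /o outcome_restr.
(* The restricted trees do not read [i], so the averaging of [f] over [i] can be undone: the
   induction hypothesis applies to the same [f], hence with the same influences. *)
have Efo b : Ex p s (fun w => avg p i f w * o (T' b) w) w =
    Ex p s (fun w => f w * o (T' b) w) w.
  rewrite -(Ex_avg p (fun w => f w * _) si); congr (Ex _ _ _ _).
  by apply/funext => v; rewrite /avg /o !outcome_restr !upd_upd; ring.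
have Eafo : Ex p s (fun w => avg p i f w * o T w) w =
    p i * Ex p s (fun w => f w * o (T' true) w) w +
    (1 - p i) * Ex p s (fun w => f w * o (T' false) w) w.
  rewrite -!Efo; apply: (Esplit (fun b w => avg p i f w * o (T' b) w)) => v b.
  by rewrite avg_upd /o outcome_restr.
have root : Ex p s (fun w => f w * o T w) w <=
    Ex p s (fun w => avg p i f w * o T w) w + influence s i f w.
  rewrite -ExD; apply: ler_Ex => // v; rewrite /o.
  case: (outcome T v) => /=; last by rewrite !mulr0 add0r.
  by rewrite !mulr1 -lerBlDl ler_norm.
pose q T j := Ex p s (fun w => (j \in queries T w)%:R) w.
have Eq j : j != i -> q T j = p i * q (T' true) j + (1 - p i) * q (T' false) j.
  move=> ji; apply: (Esplit (fun b w => (j \in queries (T' b) w)%:R)) => v b.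
  by rewrite queries_restr ji.
have q0 b : q (T' b) i = 0.
  rewrite -[RHS](Ex_cst p s 0 w); congr (Ex _ _ _ _).
  by apply/funext => v; rewrite queries_restr eqxx.
have q1 : q T i = 1.
  rewrite -[RHS](Ex_cst p s 1 w); congr (Ex _ _ _ _).
  by apply/funext => v; rewrite /= inE eqxx.
have sumE : \sum_(j <- undup s) q T j * influence s j f w = influence s i f w +
    (p i * (\sum_(j <- undup s) q (T' true) j * influence s j f w) +
     (1 - p i) * (\sum_(j <- undup s) q (T' false) j * influence s j f w)).
  have us := undup_uniq s; have {}si : i \in undup s by rewrite mem_undup.
  rewrite !(bigD1_seq i) //= q1 !q0 !mul0r !add0r mul1r; congr (_ + _).
  rewrite !mulr_sumr -big_split /=; apply: eq_bigr => j ji.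
  by rewrite Eq //; ring.
have {}IH b : Ex p s (fun w => f w * o (T' b) w) w - Ex p s f w * Ex p s (o (T' b)) w <=
    \sum_(j <- undup s) q (T' b) j * influence s j f w := IH b.
change (Ex p s (fun w => f w * o T w) w - Ex p s f w * Ex p s (o T) w <=
    \sum_(j <- undup s) q T j * influence s j f w).
rewrite sumE Eo; move: root; rewrite Eafo.
case/andP: p_i => p0 p1 root.
have p1' : 0 <= 1 - p i by rewrite subr_ge0.
have := ler_wpM2l p0 (IH true); have := ler_wpM2l p1' (IH false).
lra.
Qed.

End OSSS.

(** * Russo's formula and influences *)

Section Russo.
Context {R : realType} {E F : eqType}.
Implicit Types (t : R) (w : E + F -> bool) (s : seq (E + F)).
Implicit Types (f : (E + F -> bool) -> R) (i : F).

(* The coordinates inl e are the twists eta_e, and the coordinates inr i are the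
   states of the edges i of the lift. *)
Definition law t (j : E + F) : R := if j is inl _ then 1 / 2 else t.

Definition pivot i f w := f (upd w (inr i) true) - f (upd w (inr i) false).

Lemma law01 t : 0 <= t <= 1 -> forall j, 0 <= law t j <= 1.
Proof. by move=> t01 [e|i] //=; lra. Qed.

Lemma Ex_pivot t i s f w :
  inr i \notin s -> Ex (law t) s (pivot i f) w = pivot i (Ex (law t) s f) w.
Proof.
elim: s w => //= j s IH w; rewrite inE negb_or => /andP[ij si].
by rewrite /avg !IH // /pivot /avg ![upd (upd w j _) (inr i) _]updC 1?eq_sym //; ring.
Qed.

(** Averaging over one state is affine in [t], with the pivot as slope; the product rule adds up
    these slopes along [s]. A twist has the constant parameter 1/2 and contributes 0. *)
Lemma Russo s f w t : uniq s ->
  is_derive t 1 (fun t => Ex (law t) s f w)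
    (\sum_(j <- s) if j is inr i then Ex (law t) s (pivot i f) w else 0).
Proof.
elim: s w => [|j s IH] w /=; first by rewrite big_nil; move=> _; exact: is_derive_cst.
move=> /andP[js us].
have H b := IH (upd w j b) us.
have -> : (fun t => avg (law t) j (Ex (law t) s f) w) =
    (fun t => law t j) * (fun t => Ex (law t) s f (upd w j true)) +
    (cst 1 - (fun t => law t j)) * (fun t => Ex (law t) s f (upd w j false)) by [].
have [dl Hl] : exists dl : R, is_derive t 1 (fun t => law t j) dl /\
    dl = (if j is inr _ then 1 else 0).
  case: j {js H} => [e|i] /=; first by exists 0; split => //; exact: is_derive_cst.
  by exists 1; split => //; exact: is_derive_id.
case: Hl => Hl dlE.
have Hl' := Hl.
apply: is_derive_eq.
rewrite /GRing.scale /= big_cons.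
have split_sum : \sum_(k <- s) (if k is inr i then Ex (law t) (j :: s) (pivot i f) w else 0) =
   law t j *
     (\sum_(k <- s) if k is inr i then Ex (law t) s (pivot i f) (upd w j true) else 0) +
   (1 - law t j) *
     (\sum_(k <- s) if k is inr i then Ex (law t) s (pivot i f) (upd w j false) else 0).
  rewrite !mulr_sumr -big_split /=; apply: eq_bigr => -[e|i] _ /=; first by ring.
  by rewrite /avg.
rewrite [X in _ = _ + X]split_sum.
have -> : (if j is inr i then Ex (law t) (j :: s) (pivot i f) w else 0) =
    dl * (Ex (law t) s f (upd w j true) - Ex (law t) s f (upd w j false)).
  rewrite dlE; case: j js {H Hl Hl' dlE split_sum} => [e|i] js; first by rewrite mul0r.
  by rewrite /= /avg !Ex_pivot // /pivot !upd_upd; ring.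
rewrite /= -[(cst 1 - _) t]/(1 - law t j); ring.
Qed.

End Russo.

Section influences.
Context {R : realType} {E F : eqType}.
Variables (base : F -> E) (par : F -> bool) (lifts : E -> seq F).
Hypothesis liftsP : forall e i, (i \in lifts e) = (base i == e).
Hypothesis uniq_lifts : forall e, uniq (lifts e).
Hypothesis size_lifts : forall e, (size (lifts e) <= 4)%N.

(** [par i] is the value of the twist [base i] for which the edge [i] belongs to the lift. About the
    lift, the estimates below use only that each twist governs at most four edges. *)
Definition open_edges (w : E + F -> bool) (i : F) : bool :=
  (w (inl (base i)) == par i) && w (inr i).

Definition increasing (phi : (F -> bool) -> bool) :=
  forall O O' : F -> bool, (forall i, O i -> O' i) -> phi O -> phi O'.

Definition coords (l : seq E) : seq (E + F) :=
  map inl l ++ map inr (flatten (map lifts l)).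

Lemma uniq_coords l : uniq l -> uniq (coords l).
Proof.
move=> ul; rewrite cat_uniq; apply/and3P; split.
- by rewrite map_inj_uniq // => x y [].
- by apply/hasPn => _ /mapP[i _ ->]; apply/negP => /mapP[].
- rewrite map_inj_uniq => [|x y []] //.
  elim: l ul => //= e l IH /andP[el ul]; rewrite cat_uniq uniq_lifts IH // andbT.
  apply/hasPn => i /flattenP[_ /mapP[e' e'l ->]]; rewrite !liftsP => /eqP bi.
  by rewrite bi; apply: contraNneq el => <-.
Qed.

Variables (t : R) (l : seq E) (w0 : E + F -> bool) (phi : (F -> bool) -> bool).
Hypothesis t01 : 0 <= t <= 1.
Hypothesis phi_incr : increasing phi.

Let s := coords l.
Let f (w : E + F -> bool) : R := (phi (open_edges w))%:R.
Let E_ (g : (E + F -> bool) -> R) := Ex (law t) s g w0.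
Let l01 : forall j : E + F, 0 <= law t j <= 1 := law01 t01.

Let f_mono w w' :
  (forall i, open_edges w i -> open_edges w' i) -> f w <= f w'.
Proof.
by move=> ww'; rewrite /f ler_nat; case: (boolP (phi (open_edges w))) => // /(phi_incr ww') ->.
Qed.

Let f_inr w i b : f (upd w (inr i) false) <= f (upd w (inr i) b).
Proof.
apply: f_mono => j; rewrite /open_edges ![upd _ _ _ (inl _)]upd_neq //.
by rewrite /upd -[inr j == inr i]/(j == i); case: (j == i); rewrite ?andbF.
Qed.

Let f_inr_true w i : f w <= f (upd w (inr i) true).
Proof.
rewrite (upd_case f w (inr i)).
by case: (w (inr i)) => //; exact: f_inr.
Qed.

Lemma pivot_ge0 i w : 0 <= pivot i f w.
Proof. by rewrite subr_ge0; exact: f_inr. Qed.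

(** As [f] increases with the state of [i], its two values differ by exactly the pivot, and [f] is
    within that distance of its average. *)
Lemma influence_inr i : influence (law t) s (inr i) f w0 <= E_ (pivot i f).
Proof.
apply: ler_Ex => // w; rewrite /avg /=.
have := f_inr w i true; rewrite /pivot.
rewrite (upd_case f w (inr i)).
move: (f (upd w (inr i) true)) (f (upd w (inr i) false)) => a b.
move=> ba; case/andP: t01 => t0 t1; have ab : 0 <= a - b by lra.
rewrite ler_norml; case: (w (inr i)); apply/andP; split; nra.
Qed.

Definition close (r : seq F) w : E + F -> bool :=
  foldr (fun i w => upd w (inr i) false) w r.

Lemma closeE r w j :
  close r w j = if j is inr i then (i \notin r) && w j else w j.
Proof.
elim: r => [|k r IH] /=; first by case: j.
rewrite /upd {}IH; case: j => [e|i] //=; rewrite inE -[inr i == inr k]/(i == k).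
by case: (i == k).
Qed.

(** The edges of [r] are closed with probability at least [(1 - t)^(size r)], independently of
    [g \o close r], and on that event [g] and [g \o close r] agree. *)
Let Ex_close r g : (forall w, 0 <= g w) -> {subset r <= flatten (map lifts l)} ->
  (1 - t) ^+ size r * E_ (g \o close r) <= E_ g.
Proof.
have t1 : 0 <= 1 - t by case/andP: t01 => *; lra.
elim: r g => [|i r IH] g g0 rl; first by rewrite expr0 mul1r.
have si : inr i \in s.
  by rewrite /s mem_cat; apply/orP; right; rewrite map_f // rl // inE eqxx.
pose h w := g (upd w (inr i) false).
have := IH h (fun=> g0 _); rewrite -/(_ \o _) => {}IH.
have {IH} : (1 - t) ^+ size r * E_ (h \o close r) <= E_ h.
  by apply: IH => j jr; apply: rl; rewrite inE jr orbT.
rewrite exprS -mulrA => /(ler_wpM2l t1) /le_trans; apply.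
rewrite -ExZ /E_ -(Ex_avg (law t) g si); apply: ler_Ex => // w.
by rewrite /avg /= lerDr mulr_ge0 //; case/andP: t01.
Qed.

(** A telescoping sum: closing [i] after the rest of the list costs at most the pivot of [i] with
    that rest already closed, and [Ex_close] compares this with the unconditioned pivot. *)
Let Ex_sub_close r : {subset r <= flatten (map lifts l)} ->
  (1 - t) ^+ size r * E_ (fun w => f w - f (close r w)) <= \sum_(i <- r) E_ (pivot i f).
Proof.
have t1 : 0 <= 1 - t by case/andP: t01 => *; lra.
elim: r => [|i r IH] rl.
  rewrite big_nil expr0 mul1r /E_ -[leRHS](Ex_cst (law t) s 0 w0).
  by apply: ler_Ex => // w; rewrite subrr.
rewrite big_cons.
have rl' : {subset r <= flatten (map lifts l)}.
  by move=> j jr; apply: rl; rewrite inE jr orbT.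
have /(le_trans _) := lerD (Ex_close (pivot_ge0 i) rl') (IH rl'); apply.
rewrite -mulrDr -ExD exprS -mulrA.
have le1 : 1 - t <= 1 by case/andP: t01 => *; lra.
have Hge : 0 <= E_ (fun w => f w - f (close (i :: r) w)).
  apply: Ex_ge0 => // w; rewrite subr_ge0; apply: f_mono => j.
  by rewrite /open_edges !closeE => /and3P[-> _ ->].
apply: le_trans (_ : (1 - t) ^+ size r * E_ (fun w => f w - f (close (i :: r) w)) <= _).
  by apply: ler_piMl => //; rewrite mulr_ge0 // exprn_ge0.
rewrite ler_wpM2l ?exprn_ge0 //; apply: ler_Ex => // w /=; rewrite /pivot.
by have := f_inr_true (close r w) i; lra.
Qed.

(* Once the lifts of e are closed, the twist of e is irrelevant. They are closed
   one by one: each step costs a pivotality probability, and imposing that the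
   previous ones are closed costs a factor (1 - t)^-1 each. *)
Lemma influence_inl e : e \in l ->
  (1 - t) ^+ 4 * influence (law t) s (inl e) f w0 <=
  2 * \sum_(i <- lifts e) E_ (pivot i f).
Proof.
move=> el; have t1 : 0 <= 1 - t by case/andP: t01 => *; lra.
have le1 : 1 - t <= 1 by case/andP: t01 => *; lra.
have sub : {subset lifts e <= flatten (map lifts l)}.
  by move=> i ie; apply/flattenP; exists (lifts e) => //; exact: map_f.
have si : inl e \in s by rewrite /s mem_cat map_f.
pose z w := f (close (lifts e) w).
have zf w : z w <= f w.
  by apply: f_mono => j; rewrite /open_edges !closeE => /and3P[-> _ ->].
have zu w b : z (upd w (inl e) b) = z w.
  rewrite /z /f; congr ((phi _)%:R); apply/funext => j; rewrite /open_edges !closeE /upd /=.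
  rewrite -[inl _ == inl e]/(base j == e) liftsP.
  by case: (base j == e); rewrite ?andbF.
have /(ler_wpM2l (ler0n R 2)) /(le_trans _) := Ex_sub_close sub; apply.
(* [z] does not depend on the twist and lies below [f] at both of its values, so [f] deviates from
   its average by at most twice the averaged excess [f - z]. *)
have E2 : influence (law t) s (inl e) f w0 <= 2 * E_ (fun w => f w - z w).
  have -> : E_ (fun w => f w - z w) = E_ (avg (law t) (inl e) (fun w => f w - z w)).
    by rewrite /E_ Ex_avg.
  rewrite -ExZ; apply: ler_Ex => // w; rewrite /avg /= !zu.
  have := zf (upd w (inl e) true); have := zf (upd w (inl e) false); rewrite !zu.
  rewrite (upd_case f w (inl e)).
  move: (f (upd w (inl e) true)) (f (upd w (inl e) false)) (z w) => a b c.
  by move=> cb ca; rewrite ler_norml; case: (w (inl e)); apply/andP; split; lra.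
have Hge : 0 <= E_ (fun w => f w - z w).
  by apply: Ex_ge0 => // w; rewrite subr_ge0.
have le4 : (1 - t) ^+ 4 <= (1 - t) ^+ size (lifts e) by apply: ler_wiXn2l.
apply: le_trans (_ : (1 - t) ^+ 4 * (2 * E_ (fun w => f w - z w)) <= _).
  by rewrite ler_wpM2l ?exprn_ge0.
by rewrite mulrCA ler_wpM2l // ler_wpM2r.
Qed.

(** The constant is 3 = 1 + 2: each pivot is counted once for the state of the edge and twice for
    the twist of its base, since an edge lies over a single base edge. *)
Lemma sum_influences :
  (1 - t) ^+ 4 * \sum_(j <- s) influence (law t) s j f w0 <=
  3 * \sum_(j <- s) if j is inr i then E_ (pivot i f) else 0.
Proof.
have t1 : 0 <= 1 - t by case/andP: t01 => *; lra.
have le1 : 1 - t <= 1 by case/andP: t01 => *; lra.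
have X4 : (1 - t) ^+ 4 <= 1 by exact: exprn_ile1.
rewrite /s /coords -/coords !big_cat !big_map /= -/(coords l) -/s.
rewrite [X in _ <= 3 * (X + _)]big1 // add0r mulrDr.
set P := \sum_(i <- flatten (map lifts l)) E_ (pivot i f).
have le_inr : (1 - t) ^+ 4 *
    (\sum_(i <- flatten (map lifts l)) influence (law t) s (inr i) f w0) <= P.
  rewrite mulr_sumr; apply: ler_sum => i _.
  apply: le_trans _ (influence_inr i); apply: ler_piMl => //.
  by apply: Ex_ge0.
have le_inl : (1 - t) ^+ 4 * (\sum_(e <- l) influence (law t) s (inl e) f w0) <= 2 * P.
  rewrite /P big_flatten big_map /= !mulr_sumr !big_seq; apply: ler_sum => e el.
  exact: influence_inl.
lra.
Qed.

End influences.

(** * Clusters and their exploration *)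

Section reach.
Context {X F : eqType}.
Variables (src dst : F -> X) (inc : X -> seq F).
Hypothesis incP : forall x i, (i \in inc x) = (src i == x) || (dst i == x).
Implicit Types (O : F -> bool) (x y v : X) (i : F).

Definition other i v := if src i == v then dst i else src i.

Definition grow O (r : seq X) : seq X :=
  undup (r ++ flatten [seq [seq other i v | i <- inc v & O i] | v <- r]).

Definition reach O k x : seq X := iter k (grow O) [:: x].

Definition joined O v y :=
  exists2 i, O i & (src i = v /\ dst i = y) \/ (src i = y /\ dst i = v).

Lemma joined_sym O v y : joined O v y -> joined O y v.
Proof. by move=> [i Oi [?|?]]; exists i => //; [right|left]. Qed.

Lemma joined_ends O i : O i -> joined O (src i) (dst i).
Proof. by exists i => //; left. Qed.

Lemma mem_reachS O k x y : y \in reach O k.+1 x <->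
  y \in reach O k x \/ exists2 v, v \in reach O k x & joined O v y.
Proof.
rewrite /reach iterS -/(reach O k x) /grow mem_undup mem_cat; split.
  move=> /orP[->|/flattenP[_ /mapP[v vk ->] /mapP[i]]]; first by left.
  rewrite mem_filter incP => /andP[Oi iv] ->; right; exists v => //; exists i => //.
  rewrite /other; move: iv; case: (eqVneq (src i) v) => [->|_ /= /eqP ->]; first by left.
  by right.
move=> [->//|[v vk [i Oi iv]]]; apply/orP; right.
apply/flattenP; exists [seq other i v | i <- inc v & O i]; first exact: map_f.
have -> : y = other i v.
  by rewrite /other; case: iv => -[<- <-]; rewrite ?eqxx //; case: eqP.
apply: map_f; rewrite mem_filter Oi incP /=.
by case: iv => [[-> _]|[_ ->]]; rewrite eqxx ?orbT.
Qed.

Lemma reachW O k m x : (k <= m)%N -> {subset reach O k x <= reach O m x}.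
Proof.
move=> /subnK <-; elim: (m - k)%N => // d IH y /IH yd.
by rewrite addSn; apply/mem_reachS; left.
Qed.

Lemma reach_joined O k x y v : joined O x v -> y \in reach O k v -> y \in reach O k.+1 x.
Proof.
move=> xv; elim: k y => [|k IH] y.
  rewrite mem_seq1 => /eqP ->; apply/mem_reachS; right; exists x => //.
  by rewrite mem_seq1.
case/mem_reachS => [/IH|[u /IH uk uy]]; first exact: reachW.
by apply/mem_reachS; right; exists u.
Qed.

Lemma reach_mono O O' k x : (forall i, O i -> O' i) ->
  {subset reach O k x <= reach O' k x}.
Proof.
move=> OO'; elim: k => // k IH y /mem_reachS[/IH|[v /IH vk [i Oi iv]]].
  exact: reachW.
by apply/mem_reachS; right; exists v => //; exists i => //; exact: OO'.
Qed.

Lemma uniq_reach O k x : uniq (reach O k x).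
Proof. by case: k => //= k; rewrite undup_uniq. Qed.

(** A step that adds no vertex leaves the set unchanged for ever; until then the size grows by at
    least one at each step. *)
Lemma reach_stabilizes O k x :
  (k < size (reach O k x))%N \/ forall m, {subset reach O m x <= reach O k x}.
Proof.
elim: k => [|k [IH|IH]]; first by left.
  have [lt|ge] := ltnP (size (reach O k x)) (size (reach O k.+1 x)).
    by left; exact: leq_ltn_trans lt.
  right; have sub : {subset reach O k.+1 x <= reach O k x}.
    have [_] := uniq_min_size (uniq_reach O k x) (reachW (leqnSn k)) ge.
    by move=> E y; rewrite E.
  elim=> [|m IHm] y; first exact: (@reachW _ 0).
  case/mem_reachS => [/IHm //|[v /IHm vk vy]].
  apply/mem_reachS; right; exists v => //; exact: sub.
by right => m y /IH; exact: reachW.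
Qed.

(* The cluster of x has at least n vertices; by reach_stabilizes, it is enough to
   look at n steps. *)
Definition big O n x := (n <= size (reach O n x))%N.

Lemma big_reach O n m x : (n <= size (reach O m x))%N -> big O n x.
Proof.
move=> nm; have [|sub] := reach_stabilizes O n x; first exact: ltnW.
by apply: leq_trans nm _; apply: uniq_leq_size (sub m); exact: uniq_reach.
Qed.

Lemma bigW O k n x : (k <= n)%N -> big O n x -> big O k x.
Proof. by move=> kn nx; apply: (@big_reach _ _ n); exact: leq_trans nx. Qed.

Lemma big_mono O O' n x : (forall i, O i -> O' i) -> big O n x -> big O' n x.
Proof.
move=> OO' /leq_trans; apply; apply: uniq_leq_size; first exact: uniq_reach.
exact: reach_mono.
Qed.

(** Computed with all edges open: the list is deterministic, yet contains every edge that
    [reach O n x] can inspect. *)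
Definition nbhd n x : seq F := flatten [seq inc v | v <- reach xpredT n x].

Lemma reach_local O O' n x : {in nbhd n x, O =1 O'} -> reach O n x = reach O' n x.
Proof.
move=> OO'; suff H k : (k <= n)%N -> reach O k x = reach O' k x by exact: H.
elim: k => // k IH kn; rewrite /reach !iterS -/(reach O k x) -/(reach O' k x) -IH 1?ltnW //.
congr (undup (_ ++ flatten _)); apply/eq_in_map => v vk; congr (map _ _).
apply: eq_in_filter => i iv; apply: OO'; apply/flattenP; exists (inc v) => //.
by apply: map_f; apply: reachW (ltnW kn) _ _; apply: reach_mono vk.
Qed.

Definition conn O x y : bool := `[< exists k, y \in reach O k x >].

Lemma conn_refl O x : conn O x x.
Proof. by apply/asboolP; exists 0%N; rewrite mem_seq1. Qed.

Lemma conn_joined O x y z : conn O x y -> joined O y z -> conn O x z.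
Proof.
move=> /asboolP[k xy] yz; apply/asboolP; exists k.+1.
by apply/mem_reachS; right; exists y.
Qed.

(** A single pass along a prescribed list of edges, so that the matching decision tree is defined by
    recursion on the list. An edge met before it touches [A] is caught by a later pass, which is why
    the list is repeated when the exploration is run. *)
Fixpoint explored O (l : seq F) (A : seq X) : seq X :=
  if l is i :: l' then
    if ((src i \in A) || (dst i \in A)) && O i
    then explored O l' [:: src i, dst i & A] else explored O l' A
  else A.

Lemma sub_explored O l A : {subset A <= explored O l A}.
Proof.
elim: l A => [|i l IH] A x xA //=; case: ifP => _; apply: IH => //.
by rewrite !inE xA !orbT.
Qed.

Lemma explored_cat O l l' A : explored O (l ++ l') A = explored O l' (explored O l A).
Proof. by elim: l A => //= i l IH A; case: ifP. Qed.

Lemma explored_conn O l A x : x \in explored O l A -> exists2 y, y \in A & conn O x y.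
Proof.
elim: l A => [|i l IH] A /=; first by exists x => //; exact: conn_refl.
case: ifP => [/andP[iA Oi]|_]; last exact: IH.
move=> /IH[y]; rewrite !in_cons => yA xy; have ij := joined_ends Oi.
case/or3P: yA => [/eqP ysrc|/eqP ydst|yA]; last by exists y.
  rewrite {y}ysrc in xy; case/orP: iA => iA; first by exists (src i).
  by exists (dst i) => //; exact: conn_joined ij.
rewrite {y}ydst in xy; case/orP: iA => iA; last by exists (dst i).
by exists (src i) => //; exact: conn_joined (joined_sym ij).
Qed.

Lemma explored_open O l A i : i \in l -> O i -> (src i \in A) || (dst i \in A) ->
  (src i \in explored O l A) && (dst i \in explored O l A).
Proof.
move=> il Oi iA; case/splitPr: il => l1 l2; rewrite explored_cat /=.
have -> : (src i \in explored O l1 A) || (dst i \in explored O l1 A).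
  by case/orP: iA => /(sub_explored O l1) ->; rewrite ?orbT.
by rewrite Oi !sub_explored // !inE eqxx ?orbT.
Qed.

(** The path is followed from [y] back to [x], at least one edge per pass; all its edges lie in
    [nbhd n x]. *)
Lemma explored_reach O l n k x y A :
  {subset nbhd n x <= l} -> (k <= n)%N -> y \in reach O k x -> y \in A ->
  x \in explored O (flatten (nseq k l)) A.
Proof.
move=> nl; elim: k y A => [|k IH] y A kn; first by rewrite mem_seq1 => /eqP ->.
rewrite /= explored_cat; case/mem_reachS => [yk yA|[v vk [i Oi iv]] yA].
  by apply: (IH y) => //; [exact: ltnW|exact: sub_explored].
apply: (IH v) => //; first exact: ltnW.
have il : i \in l.
  apply: nl; apply/flattenP; exists (inc v); last first.
    by rewrite incP; case: iv => [[-> _]|[_ ->]]; rewrite eqxx ?orbT.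
  by apply: map_f; apply: reachW (ltnW kn) _ _; exact: reach_mono vk.
have /(_ A) := explored_open il Oi.
by case: iv => [[-> ->]|[-> ->]]; rewrite yA ?orbT => /(_ isT)/andP[].
Qed.

End reach.

Section exploration_tree.
Context {X E F : eqType}.
Variables (src dst : F -> X) (inc : X -> seq F) (base : F -> E) (par : F -> bool).
Variable o : X.

(** The twist is read first and the state is read in both cases, even if the twist already excludes
    the edge. Both queries are charged to the same edge touching the explored set. *)
Fixpoint exploration (l : seq F) (A : seq X) : dtree (E + F) :=
  if l is i :: l' then
    let T1 := exploration l' [:: src i, dst i & A] in
    let T0 := exploration l' A in
    if (src i \in A) || (dst i \in A) then
      Node (inl (base i))
        (Node (inr i) (if par i then T1 else T0) T0)
        (Node (inr i) (if par i then T0 else T1) T0)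
    else T0
  else Leaf (o \in A).

Lemma outcome_exploration l A w :
  outcome (exploration l A) w = (o \in explored src dst (open_edges base par w) l A).
Proof.
elim: l A => //= i l IH A; case: ifP => _ /=; last exact: IH.
rewrite [open_edges base par w i]/open_edges.
by case: (w (inl _)); case: (par i); case: (w (inr i)) => /=; exact: IH.
Qed.

Definition base_of (j : E + F) : E := match j with inl e => e | inr i => base i end.

(** This turns revealments into connection events. The edge [i] responsible for the query of [j] is
    only known to have the same base, since a twist can be read on behalf of any of its lifts. *)
Lemma queries_exploration l A w j :
  j \in queries (exploration l A) w -> exists2 i, i \in l & base i = base_of j /\
    has (mem (explored src dst (open_edges base par w) l A)) [:: src i; dst i].
Proof.
elim: l A => //= i l IH A; set O := open_edges base par w.
have IHc B : j \in queries (exploration l B) w ->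
    exists2 k, k \in i :: l & base k = base_of j /\
      has (mem (explored src dst O l B)) [:: src k; dst k].
  by move=> /IH[k kl ?]; exists k => //; rewrite inE kl orbT.
case: ifP => [iA /=|_]; last exact: IHc.
rewrite -/O.
have here B : {subset A <= B} -> (j == inl (base i)) || (j == inr i) ->
    exists2 k, k \in i :: l & base k = base_of j /\
      has (mem (explored src dst O l B)) [:: src k; dst k].
  move=> AB ji; exists i; first by rewrite inE eqxx.
  split; first by case/orP: ji => /eqP ->.
  apply/hasP; case/orP: iA => iA.
    by exists (src i); rewrite ?inE ?eqxx //=; apply/sub_explored/AB.
  by exists (dst i); rewrite ?inE ?eqxx ?orbT //=; apply/sub_explored/AB.
have AS : {subset A <= [:: src i, dst i & A]} by move=> x xA; rewrite !inE xA !orbT.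
have -> : O i = (w (inl (base i)) == par i) && w (inr i) by [].
rewrite inE => /orP[ji|].
  by case: ifP => _; apply: here => //; rewrite ji.
by case: (w (inl _)); rewrite /= inE => /orP[ji|];
  case: (par i); case: (w (inr i)) => /=; try exact: IHc;
  apply: here => //; rewrite ji orbT.
Qed.

End exploration_tree.

(** * The differential inequality *)

(** For [n > 1], the inverse of [1 - 1/n] is [1 + 1/(n - 1)], and by Bernoulli's inequality its
    [n]-th power is at least [1 + n/(n - 1) >= 2]. *)
Lemma expr_subV_le_half (R : realFieldType) n : (0 < n)%N ->
  (1 - n%:R^-1) ^+ n <= 1 / 2 :> R.
Proof.
case: n => [//|[|n]] _; first by rewrite expr1 invr1 subrr; lra.
set N := n.+2; have N0 : 0 < N%:R :> R by rewrite ltr0n.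
have n0 : 0 < n.+1%:R :> R by rewrite ltr0n.
have E : (1 - N%:R^-1)^-1 = 1 + n.+1%:R^-1 :> R.
  have NE : N%:R = n.+1%:R + 1 :> R by rewrite natr1.
  move: N0; rewrite NE => N0; field.
  by rewrite !gt_eqF // addrK.
have P : 0 < 1 - N%:R^-1 :> R by rewrite -invr_gt0 E addr_gt0 ?invr_gt0.
rewrite -[leLHS]invrK div1r lef_pV2 ?posrE ?invr_gt0 ?exprn_gt0 // -exprVn E.
have H k : 1 + k%:R * n.+1%:R^-1 <= (1 + n.+1%:R^-1) ^+ k :> R.
  elim: k => [|k IH]; first by rewrite mul0r addr0 expr0.
  rewrite exprS; have v0 : 0 <= n.+1%:R^-1 :> R by rewrite invr_ge0 ltW.
  have k0 : 0 <= k%:R :> R by [].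
  apply: le_trans (_ : (1 + n.+1%:R^-1) * (1 + k%:R * n.+1%:R^-1) <= _); last first.
    by rewrite ler_wpM2l // addr_ge0.
  move: (n.+1%:R^-1) v0 => v v0; rewrite -natr1.
  have : 0 <= k%:R * (v * v) by rewrite !mulr_ge0.
  lra.
apply: le_trans (H N).
have -> : N%:R = n.+1%:R + 1 :> R by rewrite natr1.
rewrite mulrDl divff ?gt_eqF // mul1r.
have : 0 <= n.+1%:R^-1 :> R by rewrite invr_ge0 ltW.
move: (n.+1%:R^-1) => v v0; lra.
Qed.

Section ghost.
Context {R : realType} {X F : eqType}.
Variables (src dst : F -> X) (inc : X -> seq F).
Hypothesis incP : forall x i, (i \in inc x) = (src i == x) || (dst i == x).
Variables (h : R) (L : seq X).
Hypothesis h01 : 0 <= h <= 1.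
Implicit Types (O : F -> bool) (G : X -> bool).

Let E_ (f : (X -> bool) -> R) := Ex (fun=> h) L f (fun=> false).

Lemma ghost_miss (r : seq X) : uniq r -> {subset r <= L} ->
  E_ (fun G => (all (predC G) r)%:R) = (1 - h) ^+ size r.
Proof.
move=> + rL; rewrite /E_ (@Ex_superset _ _ _ r); first last.
- by [].
- by move=> G G' e; congr (_%:R); congr nat_of_bool; apply: eq_in_all => x xr /=; rewrite e.
move: (fun=> false) => v; clear rL; elim: r v => [|x r IH] v; first by rewrite expr0.
move=> /= /andP[xr ur]; rewrite avg_Ex exprS -(IH v ur) -ExZ; congr (Ex _ _ _ _).
apply/funext => G; rewrite /avg /= upd_eq mulr0 add0r upd_eq /=; congr (_ * _%:R).
congr nat_of_bool; apply: eq_in_all => y yr /=; rewrite upd_neq //.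
by apply: contraNneq xr => <-.
Qed.

Lemma ghost_vertex x : E_ (fun G => (G x)%:R) <= h.
Proof.
have [xL|xL] := boolP (x \in L).
  rewrite /E_ -(Ex_avg _ _ xL) (_ : avg _ _ _ = fun=> h) ?Ex_cst //.
  by apply/funext => G; rewrite /avg !upd_eq /= mulr1 mulr0 addr0.
rewrite /E_ Ex_indep; first by case/andP: h01.
move=> y yL w b; rewrite upd_neq //; apply: contraNneq xL => ->; exact: yL.
Qed.

Definition hit O G x := has (fun y => G y && conn src dst inc O x y) L.

(** A union bound over the cluster K of [x] gives [min(|K|, n) / n], and [min(|K|, n)] is the number
    of [k] in [1..n] with [|K| >= k]. Averaging over the percolation turns the right side into
    [m]. *)
Lemma ghost_hit O x n : (0 < n)%N -> h = n%:R^-1 ->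
  E_ (fun G => (hit O G x)%:R) <=
  n%:R^-1 * \sum_(1 <= k < n.+1) (big src dst inc O k x)%:R.
Proof.
move=> n0 hn; have n0' : 0 < n%:R :> R by rewrite ltr0n.
have hh := h01.
have [bn|nb] := boolP (big src dst inc O n x).
  rewrite [leRHS](_ : _ = 1); first by apply: Ex_le1 => // G; case: hit.
  rewrite big_nat (eq_bigr (fun=> 1)) => [|k /andP[_]]; last first.
    by rewrite ltnS => kn; rewrite (bigW incP kn bn).
  by rewrite -big_nat big_const_nat subn1 /= iter_addr addr0 -mulr_natl mulr1 mulVf ?gt_eqF.
have [|sub] := reach_stabilizes incP O n x; first by move=> /ltnW bn; case/negP: nb.
set r := reach src dst inc O n x in sub.
have rn : (size r < n)%N by rewrite ltnNge.
apply: le_trans (_ : E_ (fun G => \sum_(y <- r) (G y)%:R) <= _).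
  apply: ler_Ex => // G; rewrite /hit; case: hasP => [[y yL /andP[Gy /asboolP[k]]]|_].
    move=> /sub yr; rewrite (bigD1_seq y) ?Gy ?uniq_reach //= lerDl.
    by apply: sumr_ge0.
  exact: sumr_ge0.
rewrite /E_ Ex_sum; apply: le_trans (_ : \sum_(y <- r) h <= _).
  by apply: ler_sum => y _; exact: ghost_vertex.
rewrite big_const_seq count_predT iter_addr addr0 -[leLHS]mulr_natr hn.
rewrite ler_wpM2l ?invr_ge0 ?ler0n //.
rewrite (@big_cat_nat _ _ _ (size r).+1) //=; last by rewrite ltnS ltnW.
rewrite big_nat (eq_bigr (fun=> 1)) => [|k /andP[_]]; last first.
  by rewrite ltnS => kr; rewrite (@big_reach _ _ _ _ _ incP _ _ n).
rewrite -big_nat big_const_nat subn1 /= iter_addr addr0 lerDl.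
by apply: sumr_ge0.
Qed.

End ghost.

Section differential_inequality.
Context {R : realType} {X E F : eqType}.
Variables (src dst : F -> X) (inc : X -> seq F).
Variables (base : F -> E) (par : F -> bool) (lifts : E -> seq F).
Hypothesis incP : forall x i, (i \in inc x) = (src i == x) || (dst i == x).
Hypothesis liftsP : forall e i, (i \in lifts e) = (base i == e).
Hypothesis uniq_lifts : forall e, uniq (lifts e).
Hypothesis size_lifts : forall e, (size (lifts e) <= 4)%N.

Definition large k x (w : E + F -> bool) : bool :=
  big src dst inc (open_edges base par w) k x.

Definition support k x : seq E := undup (map base (nbhd src dst inc k x)).

Definition theta k x (t : R) : R :=
  Ex (law t) (coords lifts (support k x)) (fun w => (large k x w)%:R) (fun=> false).

Lemma mem_coords l j : (j \in coords lifts l) = (base_of base j \in l).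
Proof.
rewrite mem_cat; case: j => [e|i] /=.
  rewrite mem_map => [|? ? [] //]; case: (e \in l) => //=.
  by apply/negbTE/mapP => -[].
rewrite [X in X || _](_ : _ = false) /=; last by apply/negbTE/mapP => -[].
rewrite mem_map => [|? ? [] //]; apply/flattenP/idP => [[_ /mapP[e el ->]]|il].
  by rewrite liftsP => /eqP ->.
by exists (lifts (base i)); [exact: map_f|rewrite liftsP].
Qed.

Lemma large_depends k x : depends_on (coords lifts (support k x)) (large k x).
Proof.
move=> w w' e; rewrite /large /big.
rewrite (@reach_local _ _ src dst inc incP _ (open_edges base par w')) //.
move=> i ik; have bi : base i \in support k x by rewrite mem_undup map_f.
by rewrite /open_edges !e // mem_coords.
Qed.

Lemma thetaE k x t l w : {subset support k x <= l} ->
  Ex (law t) (coords lifts l) (fun w => (large k x w)%:R) w = theta k x t.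
Proof.
move=> sub; have dep : depends_on (coords lifts (support k x)) (fun w => (large k x w)%:R : R).
  by move=> u u' e; rewrite (large_depends e).
rewrite (Ex_superset _ dep); first exact: Ex_base.
by move=> j; rewrite !mem_coords => /sub.
Qed.

Variable o : X.
Hypothesis theta_hom : forall k x t, theta k x t = theta k o t.

(** The covariance in OSSS is at least [theta_n (1/2 - m)], and each revealment is at most [8 m],
    for four lifts with two ends each. With the 3 of [sum_influences] this makes 24. *)
Lemma theta_ghost_inequality n (t : R) : (0 < n)%N -> 0 <= t <= 1 ->
  let m := n%:R^-1 * \sum_(1 <= k < n.+1) theta k o t in
  exists D : R, [/\ is_derive t 1 (theta n o) D, 0 <= D &
    (1 - t) ^+ 4 * (theta n o t * (1 / 2 - m)) <= 24 * m * D].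
Proof.
move=> n0 t01 m.
have n0' : 0 < n%:R :> R by rewrite ltr0n.
have h01 : 0 <= (n%:R^-1 : R) <= 1.
  by rewrite invr_ge0 ltW //= invf_le1 // ler1n.
set h : R := n%:R^-1 in h01 *.
pose L := nbhd src dst inc n o; pose Lambda := reach src dst inc xpredT n o.
pose xs := o :: flatten [seq [:: src i; dst i] | i <- L].
(* One list of base edges carrying all the events in use: [large k x] for [k <= n] and [x] either
   [o] or an end of an edge that may be queried. *)
pose l := undup (flatten [seq support k x | k <- iota 0 n.+1, x <- xs]).
pose s := coords lifts l; pose w0 : E + F -> bool := fun=> false.
have us : uniq s by apply: (uniq_coords liftsP uniq_lifts); exact: undup_uniq.
have sub k x : (k <= n)%N -> x \in xs -> {subset support k x <= l}.
  move=> kn xxs e ek; rewrite mem_undup; apply/flattenP; exists (support k x) => //.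
  by apply/allpairsP; exists (k, x); rewrite mem_iota.
have srcxs i : i \in L -> src i \in xs.
  move=> iL; rewrite inE; apply/orP; right; apply/flattenP.
  by exists [:: src i; dst i]; [exact: map_f|rewrite !inE eqxx].
have dstxs i : i \in L -> dst i \in xs.
  move=> iL; rewrite inE; apply/orP; right; apply/flattenP.
  by exists [:: src i; dst i]; [exact: map_f|rewrite !inE eqxx orbT].
have oxs : o \in xs by rewrite inE eqxx.
pose f (w : E + F -> bool) : R := (large n o w)%:R.
have thetaEx : theta n o = fun t => Ex (law t) s f w0.
  by apply/funext => u; rewrite (thetaE _ _ (sub _ _ (leqnn n) oxs)).
pose D := \sum_(j <- s) if j is inr i then Ex (law t) s (pivot i f) w0 else 0.
have incr : increasing (fun O => big src dst inc O n o).
  by move=> O O' OO'; exact: big_mono.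
exists D; split; first by rewrite thetaEx; exact: Russo.
  apply: sumr_ge0 => -[e|i] _ //; apply: Ex_ge0 => [|w]; first exact: law01.
  exact: (pivot_ge0 base par incr).
have := sum_influences par liftsP size_lifts l w0 t01 incr.
rewrite -/s -/w0 => le_infl.
(* Green vertices farther than [n] steps from [o] are ignored, and [n] passes over [L] trace any
   path of at most [n] steps. Longer connections may be missed, but the lower bound [EGout_large]
   uses only vertices reached within [n] steps. *)
pose T G := exploration src dst base par o (flatten (nseq n L)) [seq y <- Lambda | G y].
have memL i : i \in flatten (nseq n L) -> i \in L.
  by case/flattenP => _ /nseqP[-> _].
have queryP G w j : j \in queries (T G) w -> exists2 i, i \in L & base i = base_of base j /\
    (hit src dst inc Lambda (open_edges base par w) G (src i) ||
     hit src dst inc Lambda (open_edges base par w) G (dst i)).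
  move=> /queries_exploration[i /memL iL [bi /hasP[x xi xe]]]; exists i => //; split => //.
  have [y] := explored_conn incP xe; rewrite mem_filter => /andP[Gy yL] xy.
  have hx : hit src dst inc Lambda (open_edges base par w) G x.
    by apply/hasP; exists y => //; rewrite Gy.
  by move: xi; rewrite !in_cons in_nil orbF => /orP[] /eqP <-; rewrite hx ?orbT.
have qs G w : {subset queries (T G) w <= s}.
  move=> j /queryP[i iL [bi _]]; rewrite mem_coords -bi.
  apply: (sub _ _ (leqnn n) oxs); rewrite mem_undup; exact: map_f.
pose EG (g : (X -> bool) -> R) := Ex (fun=> h) Lambda g (fun=> false).
pose Ew (g : (E + F -> bool) -> R) := Ex (law t) s g w0.
pose out G w : R := (outcome (T G) w)%:R.
have p01 := @law01 R E F t t01.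
(* OSSS is applied for each fixed [G] and then averaged: the tree depends on [G], whereas [f] and
   its influences do not. *)
have osss : EG (fun G => Ew (fun w => f w * out G w) - Ew f * Ew (out G)) <=
    EG (fun G => \sum_(j <- s) Ew (fun w => (j \in queries (T G) w)%:R) *
      influence (law t) s j f w0).
  apply: ler_Ex => // G; have := OSSS p01 f w0 (qs G).
  by rewrite undup_id.
have EGle x w : EG (fun G => (hit src dst inc Lambda (open_edges base par w) G x)%:R) <=
    h * \sum_(1 <= k < n.+1) (large k x w)%:R by exact: ghost_hit.
(* Homogeneity enters here: by [theta_hom] the bound is the same [m] at every vertex. *)
have Em x : x \in xs -> Ew (fun w => h * \sum_(1 <= k < n.+1) (large k x w)%:R) = m.
  move=> xxs; rewrite /Ew ExZ Ex_sum /m; congr (_ * _); rewrite big_nat [RHS]big_nat.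
  apply: eq_bigr => k /andP[_ kn].
  by rewrite (thetaE _ _ (sub _ _ _ xxs)).
have m0 : 0 <= m.
  rewrite -(Em o oxs); apply: Ex_ge0 => // w; rewrite mulr_ge0 //; first by case/andP: h01.
  exact: sumr_ge0.
have reveal j : EG (fun G => Ew (fun w => (j \in queries (T G) w)%:R)) <= 8 * m.
  rewrite /EG /Ew Ex_Fubini.
  pose r := [seq i <- lifts (base_of base j) | i \in L].
  apply: (@le_trans _ _ (Ew (fun w => \sum_(i <- r)
    (h * \sum_(1 <= k < n.+1) (large k (src i) w)%:R +
     h * \sum_(1 <= k < n.+1) (large k (dst i) w)%:R)))).
    apply: ler_Ex => // w.
    apply: (@le_trans _ _ (EG (fun G => \sum_(i <- r)
      ((hit src dst inc Lambda (open_edges base par w) G (src i))%:R +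
       (hit src dst inc Lambda (open_edges base par w) G (dst i))%:R)))).
      apply: ler_Ex => // G; case: (boolP (j \in _)) => [/queryP[i iL [bi hi]]|_]; last first.
        by apply: sumr_ge0 => i _; rewrite addr_ge0.
      have ir : i \in r by rewrite mem_filter iL liftsP bi /=.
      rewrite (bigD1_seq i) ?filter_uniq //=.
      apply: (@le_trans _ _ ((hit src dst inc Lambda (open_edges base par w) G (src i))%:R +
        (hit src dst inc Lambda (open_edges base par w) G (dst i))%:R)).
        by case/orP: hi => ->; rewrite ?lerDl ?lerDr.
      by rewrite lerDl; apply: sumr_ge0 => k _; rewrite addr_ge0.
    by rewrite /EG Ex_sum; apply: ler_sum => i _; rewrite ExD lerD //; exact: EGle.
  rewrite /Ew Ex_sum; apply: (@le_trans _ _ (\sum_(i <- r) (2 * m))).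
    rewrite !big_seq; apply: ler_sum => i; rewrite mem_filter => /andP[iL _].
    rewrite ExD -!/(Ew _) !Em ?srcxs ?dstxs //; lra.
  rewrite big_const_seq count_predT iter_addr addr0 -[leLHS]mulr_natr.
  have : (size r <= 4)%N.
    by apply: leq_trans (size_lifts (base_of base j)); rewrite size_filter count_size.
  rewrite -(ler_nat R) => /(ler_wpM2l (mulr_ge0 (ler0n _ 2) m0)).
  lra.
have upper : EG (fun G => \sum_(j <- s) Ew (fun w => (j \in queries (T G) w)%:R) *
      influence (law t) s j f w0) <= 8 * m * \sum_(j <- s) influence (law t) s j f w0.
  rewrite /EG Ex_sum mulr_sumr; apply: ler_sum => j _.
  rewrite (_ : (fun G => _) = fun G => influence (law t) s j f w0 *
      Ew (fun w => (j \in queries (T G) w)%:R)); last first.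
    by apply/funext => G; rewrite mulrC.
  by rewrite ExZ mulrC ler_wpM2r ?Ex_ge0 //; exact: reveal.
have EGout w : EG (out^~ w) <= h * \sum_(1 <= k < n.+1) (large k o w)%:R.
  apply: le_trans (EGle o w); apply: ler_Ex => // G; rewrite /out outcome_exploration.
  case: (boolP (o \in _)) => // /(explored_conn incP)[y].
  rewrite mem_filter => /andP[Gy yL] oy.
  rewrite (_ : hit _ _ _ _ _ _ _ = true) //.
  by apply/hasP; exists y => //; rewrite Gy.
(* If the cluster has [n] vertices, [n] of them are already reached in [n] steps; they are all
   non-green with probability [(1 - 1/n)^n <= 1/2], and otherwise the tree answers yes. *)
have EGout_large w : f w * (1 / 2) <= f w * EG (out^~ w).
  rewrite /f; case: (boolP (large n o w)) => [big_w|_]; last by rewrite !mul0r.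
  rewrite !mul1r; set r := take n (reach src dst inc (open_edges base par w) n o).
  have sr : size r = n by rewrite size_takel.
  have ur : uniq r by rewrite take_uniq // uniq_reach.
  have rL : {subset r <= Lambda}.
    by move=> y /mem_take; apply: reach_mono.
  have := ghost_miss h ur rL; rewrite sr => miss.
  have half := @expr_subV_le_half R n n0; rewrite -/h -miss in half.
  apply: (@le_trans _ _ (1 - EG (fun G => (all (predC G) r)%:R))); first by rewrite /EG; lra.
  rewrite -[X in X - _](Ex_cst (fun=> h) Lambda 1 (fun=> false)) -ExB.
  apply: ler_Ex => // G; rewrite /out outcome_exploration.
  have [_|] := boolP (all (predC G) r); first by rewrite subrr.
  case/allPn => y yr; rewrite negbK => Gy; rewrite subr0.
  rewrite (explored_reach incP (n := n) (y := y)) //; first exact: mem_take yr.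
  by rewrite mem_filter Gy rL.
have lower : theta n o t * (1 / 2 - m) <=
    EG (fun G => Ew (fun w => f w * out G w) - Ew f * Ew (out G)).
  rewrite /EG ExB ExZ -/(EG _) mulrBr lerB //.
    rewrite /EG /Ew Ex_Fubini thetaEx mulrC -ExZ; apply: ler_Ex => // w.
    by rewrite ExZ mulrC; exact: EGout_large.
  rewrite thetaEx -/(Ew f) ler_wpM2l ?Ex_ge0 //.
  by rewrite /Ew Ex_Fubini -(Em o oxs); apply: ler_Ex => // w; exact: EGout.
have t4 : 0 <= (1 - t) ^+ 4 by rewrite exprn_ge0 // subr_ge0; case/andP: t01.
have := ler_wpM2l t4 (le_trans lower (le_trans osss upper)).
move=> /le_trans; apply; rewrite mulrCA.
have /le_trans := ler_wpM2l (mulr_ge0 (ler0n R 8) m0) le_infl; apply.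
by rewrite -/D; lra.
Qed.

End differential_inequality.

(** * Integration of the differential inequality *)

Section growth.
Context {R : realType}.
Implicit Types (f : R -> R) (a b K : R).

Lemma ge_slope f a b K : a <= b ->
  (forall t, a <= t <= b -> exists2 D : R, is_derive t 1 f D & K <= D) ->
  K * (b - a) <= f b - f a.
Proof.
move=> ab df.
have H t : t \in `[a, b] -> is_derive t 1 f ('D_1 f t) /\ K <= 'D_1 f t.
  rewrite in_itv /= => /df[D fD KD].
  rewrite (@derive_val _ _ _ _ _ _ _ fD); split => //.
have cf : {within `[a, b], continuous f}.
  by apply: derivable_within_continuous => t /H[[]].
have df' t : t \in `]a, b[ -> is_derive t 1 f ('D_1 f t).
  by move=> tab; case: (H t (subset_itv_oo_cc tab)).
have [c cab ->] := MVT_segment ab df' cf.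
by rewrite ler_wpM2r ?subr_ge0 //; case: (H c cab).
Qed.

(** Gronwall's argument: [expR (- K (t - a)) * f t] has a nonnegative derivative. *)
Lemma growth_expR f a b K : a <= b ->
  (forall t, a <= t <= b -> exists2 D : R, is_derive t 1 f D & K * f t <= D) ->
  f a <= expR (- (K * (b - a))) * f b.
Proof.
move=> ab df.
pose g (t : R) : R := expR (- (K * (t - a))) * f t.
have : 0 * (b - a) <= g b - g a.
  apply: ge_slope ab _ => t /df[D fD KD].
  have -> : g = (fun t : R => expR (- (K * (t - a)))) * f by [].
  have dE : is_derive t 1 (fun t : R => expR (- (K * (t - a)))) (- K * expR (- (K * (t - a)))).
    have -> : (fun t : R => expR (- (K * (t - a)))) =
        expR \o (fun t : R => - (K * (t - a))) by [].
    apply: is_derive_eq.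
    by rewrite /GRing.scale /=; ring.
  exists (expR (- (K * (t - a))) * (D - K * f t)); last first.
    by rewrite mulr_ge0 ?expR_ge0 // subr_ge0.
  by apply: is_derive_eq; rewrite /GRing.scale /=; ring.
by rewrite mul0r subr_ge0 /g subrr mulr0 oppr0 expR0 mul1r.
Qed.

End growth.

Section sharpness.
Context {R : realType}.
Variables (theta : nat -> R -> R) (p b c : R).
Hypothesis p_ge0 : 0 <= p.
Hypothesis p_lt_b : p < b.
Hypothesis b_lt1 : b < 1.
Hypothesis b_le_c : b <= c.
Hypothesis c_le1 : c <= 1.
Hypothesis theta01 : forall n t, 0 <= t <= 1 -> 0 <= theta n t <= 1.
Hypothesis theta1 : forall t, 0 <= t <= 1 -> theta 1 t = 1.
Hypothesis theta_dec : forall n t, 0 <= t <= 1 -> theta n.+1 t <= theta n t.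
Hypothesis theta_ineq : forall n t, (0 < n)%N -> 0 <= t <= 1 ->
  let m := n%:R^-1 * \sum_(1 <= k < n.+1) theta k t in
  exists D : R, [/\ is_derive t 1 (theta n) D, 0 <= D &
    (1 - t) ^+ 4 * (theta n t * (1 / 2 - m)) <= 24 * m * D].
Hypothesis theta_lim : forall e : R, 0 < e -> exists N, forall n, (N <= n)%N -> theta n c <= e.

Let S n t : R := \sum_(1 <= k < n.+1) theta k t.
(** Here 96 = 4 * 24: the factor [1/2 - m] is bounded below by 1/4, and 24 comes from [theta_ineq].
    The power of [1 - b] bounds that of [1 - t] on [[p, b]]. *)
Let kappa : R := (1 - b) ^+ 4 / 96.

Let kappa_gt0 : 0 < kappa.
Proof. by rewrite divr_gt0 // exprn_gt0 // subr_gt0. Qed.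

Let in01 t : p <= t <= b -> 0 <= t <= 1.
Proof.
by move=> /andP[pt tb]; rewrite (le_trans p_ge0) //= (le_trans tb) // ltW.
Qed.

Let SS n t : S n.+1 t = S n t + theta n.+1 t.
Proof. by rewrite /S big_nat_recr. Qed.

Let theta_mono n s t : (0 < n)%N -> 0 <= s -> s <= t -> t <= 1 -> theta n s <= theta n t.
Proof.
move=> n0 s0 st t1; rewrite -subr_ge0 -[leLHS](mul0r (t - s)).
apply: ge_slope => // u /andP[su ut].
have u01 : 0 <= u <= 1 by rewrite (le_trans s0) //= (le_trans ut).
by have [D [dD D0 _]] := theta_ineq n0 u01; exists D.
Qed.

Let theta_lim_b e : 0 < e -> exists N, forall n, (N <= n)%N -> theta n b <= e.
Proof.
move=> e0; have [N HN] := theta_lim e0; exists N.+1 => n Nn.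
apply: le_trans (HN n (ltnW Nn)); apply: theta_mono => //; first exact: leq_ltn_trans Nn.
by rewrite (le_trans p_ge0) // ltW.
Qed.

Let S_mono n s t : 0 <= s -> s <= t -> t <= 1 -> S n s <= S n t.
Proof.
move=> s0 st t1; rewrite /S big_nat [leRHS]big_nat; apply: ler_sum => k /andP[k0 _].
exact: theta_mono.
Qed.

Let S_ge1 n t : (0 < n)%N -> 0 <= t <= 1 -> 1 <= S n t.
Proof.
case: n => // n _ t01; elim: n => [|n IH]; first by rewrite /S big_nat1 theta1.
by rewrite SS (le_trans IH) // lerDl; case/andP: (theta01 n.+2 t01).
Qed.

Let S_len n t : 0 <= t <= 1 -> S n t <= n%:R.
Proof.
move=> t01; elim: n => [|n IH]; first by rewrite /S big_geq.
by rewrite SS -natr1 lerD //; case/andP: (theta01 n.+1 t01).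
Qed.

(** [S n b / n] is the mean [m] at [b]. With [e = 1/4] and [S] monotone in [t], the factor [1/2 - m]
    is at least 1/4 on all of [[p, b]] for large [n]. *)
Let cesaro e : 0 < e -> exists N, forall n, (N <= n)%N -> S n b <= e * n%:R.
Proof.
move=> e0; have b01 : 0 <= b <= 1 by apply: in01; rewrite lexx ltW.
have e2 : 0 < e / 2 by rewrite divr_gt0.
have [N0 HN] := theta_lim_b e2.
have H n : S n b <= N0%:R + e / 2 * n%:R.
  have [nN|] := leqP n N0.
    rewrite (le_trans (S_len n b01)) // -[leLHS]addr0 lerD ?ler_nat //.
    by rewrite mulr_ge0 // ltW.
  elim: n => // n IH; rewrite ltnS leq_eqVlt SS -[n.+1%:R]natr1 mulrDr mulr1 addrA.
  move=> /predU1P[<-|N0n]; rewrite lerD //.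
  - by rewrite (le_trans (S_len N0 b01)) // lerDl mulr_ge0 // ltW.
  - exact: HN.
  - exact: IH.
  - by apply: HN; exact: leq_trans (ltnW N0n) _.
have [N1 HN1] : exists N1 : nat, N0%:R * (2 / e) <= N1%:R.
  exists (Num.bound (N0%:R * (2 / e))); apply/ltW/archi_boundP.
  by rewrite mulr_ge0 // divr_ge0 // ltW.
exists N1 => n N1n; apply: le_trans (H n) _.
have : N0%:R <= e / 2 * n%:R.
  have : N0%:R * (2 / e) <= n%:R by rewrite (le_trans HN1) // ler_nat.
  by rewrite mulrA ler_pdivrMr // => h; lra.
by lra.
Qed.

Let derivative_bound : exists2 N, (2 <= N)%N & forall n t, (N <= n)%N -> p <= t <= b ->
  exists D : R, [/\ is_derive t 1 (theta n) D, 0 <= D &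
    kappa * n%:R * theta n t <= S n t * D].
Proof.
have [|N HN] := @cesaro (1 / 4); first by lra.
exists (maxn N 2); first by rewrite leq_maxr.
move=> n t; rewrite geq_max => /andP[Nn n2] ptb; have t01 := in01 ptb.
have n0 : (0 < n)%N by exact: ltnW.
have n0' : 0 < n%:R :> R by rewrite ltr0n.
have [D [dD D0 ineq]] := theta_ineq n0 t01; exists D; split=> //.
case/andP: ptb => pt tb; case/andP: (t01) => t0 t1.
have St : S n t <= 1 / 4 * n%:R.
  by apply: le_trans (HN n Nn); apply: S_mono => //; exact: ltW.
set m := n%:R^-1 * _ in ineq.
have mS : m * n%:R = S n t by rewrite /m mulrAC mulVf ?gt_eqF // mul1r.
have m4 : m <= 1 / 4 by rewrite -(ler_pM2r n0') mS.
have th0 : 0 <= theta n t by case/andP: (theta01 n t01).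
have b0 : 0 <= 1 - b by rewrite subr_ge0 ltW.
have b4 : (1 - b) ^+ 4 <= (1 - t) ^+ 4 by apply: lerXn2r; rewrite ?nnegrE; lra.
have h1 : (1 - b) ^+ 4 * (theta n t * (1 / 4)) <= 24 * m * D.
  apply: le_trans ineq; apply: ler_pM => //; first exact: exprn_ge0.
    by rewrite mulr_ge0.
  by rewrite ler_wpM2l //; lra.
rewrite -mS /kappa; have := ler_wpM2r (ltW n0') h1.
move: ((1 - b) ^+ 4) => B; lra.
Qed.

Let inv_le_ln n : (1 < n)%N -> n%:R^-1 <= ln n%:R - ln n.-1%:R :> R.
Proof.
case: n => [|[|n]] // _; rewrite [_.-1]/=.
have n1 : 0 < n.+1%:R :> R by rewrite ltr0n.
have n2 : 0 < n.+2%:R :> R by rewrite ltr0n.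
rewrite -lerN2 opprB -ln_div ?posrE //.
have -> : n.+1%:R / n.+2%:R = 1 + - n.+2%:R^-1 :> R.
  have E : n.+2%:R = n.+1%:R + 1 :> R by rewrite natr1.
  rewrite E in n2 *; field; exact: lt0r_neq0.
apply: le_ln1Dx; rewrite ltrN2 invf_lt1 // ltr1n //.
Qed.

Let harmonic_le N n : (1 < N)%N -> (N <= n)%N ->
  \sum_(N <= k < n) k%:R^-1 <= ln n%:R :> R.
Proof.
move=> N1 Nn.
have pred_gt0 k : (1 < k)%N -> (0 < k.-1)%N by case: k => [|[]].
suff H : \sum_(N <= k < n) k%:R^-1 <= ln n.-1%:R - ln N.-1%:R :> R.
  apply: le_trans H _; have l0 : 0 <= ln N.-1%:R :> R.
    by rewrite ln_ge0 // ler1n pred_gt0.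
  have n1 : (1 < n)%N by exact: leq_trans Nn.
  have : ln n.-1%:R <= ln n%:R :> R.
    by rewrite ler_ln ?posrE ?ltr0n ?ler_nat ?leq_pred ?pred_gt0 // ltnW.
  lra.
elim: n Nn => [|n IH]; first by rewrite leqNgt ltnW.
rewrite leq_eqVlt => /predU1P[<-|]; first by rewrite big_geq // subrr.
rewrite ltnS => Nn; rewrite big_nat_recr //=.
have := inv_le_ln (leq_trans N1 Nn); have := IH Nn.
lra.
Qed.

(* This bounds the increment between s and b of the sum of theta_n / n over
   N <= n < M: its derivative is at least kappa times the sum of theta_n / S_n,
   and theta_n / S_n >= ln S_(n+1) - ln S_n. *)
Let log_growth N s e M : (2 <= N)%N ->
  (forall n t, (N <= n)%N -> p <= t <= b ->
    exists D : R, [/\ is_derive t 1 (theta n) D, 0 <= D &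
      kappa * n%:R * theta n t <= S n t * D]) ->
  (forall n, (N <= n)%N -> theta n b <= e) -> 0 <= e -> p <= s <= b ->
  (N <= M)%N ->
  kappa * (b - s) * (ln (S M s) - ln N%:R) <= e * ln M%:R.
Proof.
move=> N2 HD HN e0 /andP[ps sb] NM.
pose T M' (t : R) := \sum_(N <= n < M') n%:R^-1 * theta n t.
have b01 : 0 <= b <= 1 by apply: in01; rewrite lexx ltW.
have s01 : 0 <= s <= 1 by apply: in01; rewrite ps sb.
have N0 : (0 < N)%N by exact: ltnW.
have Tb : T M b <= e * ln M%:R.
  apply: le_trans (_ : e * (\sum_(N <= n < M) n%:R^-1) <= _); last first.
    by rewrite ler_wpM2l // harmonic_le.
  rewrite /T mulr_sumr big_nat [leRHS]big_nat; apply: ler_sum => n /andP[Nn _].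
  by rewrite mulrC ler_wpM2r ?invr_ge0 // HN.
have Ts : 0 <= T M s.
  apply: sumr_ge0 => n _; rewrite mulr_ge0 ?invr_ge0 //.
  by have /andP[] : 0 <= theta n s <= 1 by apply/theta01/in01; rewrite ps.
have T_slope t M' : p <= t <= b -> (N <= M')%N ->
    exists2 D : R, is_derive t 1 (T M') D & kappa * (ln (S M' t) - ln (S N t)) <= D.
  move=> ptb; have t01 := in01 ptb; elim: M' => [|M' IH]; first by rewrite leqn0 gtn_eqF.
  rewrite leq_eqVlt => /predU1P[<-|].
    exists 0; last by rewrite subrr mulr0.
    rewrite (_ : T N = cst 0); first exact: is_derive_cst.
    by apply/funext => u; rewrite /T big_geq.
  rewrite ltnS => NM'; have [D dD hD] := IH NM'.
  have [D' [dD' _ hD']] := HD M' t NM' ptb.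
  have M0 : 0 < M'%:R :> R by rewrite ltr0n (leq_trans N0).
  have S1 := S_ge1 (leq_trans N0 NM') t01.
  have S0 : 0 < S M' t by apply: lt_le_trans S1.
  exists (D + M'%:R^-1 * D').
    rewrite (_ : T M'.+1 = T M' + (cst M'%:R^-1 : R -> R) * theta M'); last first.
      by apply/funext => u; rewrite /T big_nat_recr.
    by apply: is_derive_eq; rewrite /GRing.scale /= mulr0 addr0.
  have ln_step : ln (S M'.+1 t) - ln (S M' t) <= theta M' t / S M' t.
    have th0 : 0 <= theta M'.+1 t by case/andP: (theta01 M'.+1 t01).
    rewrite -ln_div ?posrE //; last by rewrite SS; apply: ltr_wpDr.
    rewrite SS mulrDl divff ?gt_eqF //.
    apply: le_trans (le_ln1Dx _) _.
      by apply: lt_le_trans (_ : 0 <= _); rewrite ?ltrN10 // divr_ge0 // ltW.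
    by rewrite ler_wpM2r ?invr_ge0 ?theta_dec // ltW.
  have step : kappa * (theta M' t / S M' t) <= M'%:R^-1 * D'.
    rewrite mulrA ler_pdivrMr // -[leRHS]mulrA [leRHS]mulrC ler_pdivlMr //.
    by rewrite (mulrC D') (le_trans _ hD') // mulrAC.
  have := ler_wpM2l (ltW kappa_gt0) ln_step; move: hD step.
  by lra.
(* On [[s, b]], [S M t >= S M s] by monotonicity and [S N t <= N], which makes the lower bound on
   the slope independent of [t]. *)
have slope : kappa * (ln (S M s) - ln N%:R) * (b - s) <= T M b - T M s.
  apply: ge_slope sb _ => t /andP[st tb].
  have ptb : p <= t <= b by rewrite (le_trans ps).
  have [D dD hD] := T_slope t M ptb NM; exists D => //; apply: le_trans hD.
  have t01 := in01 ptb; rewrite ler_wpM2l ?(ltW kappa_gt0) // lerB //.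
    have S0 u : 0 <= u <= 1 -> 0 < S M u.
      by move=> u01; exact: lt_le_trans ltr01 (S_ge1 (leq_trans N0 NM) u01).
    rewrite ler_ln ?posrE ?S0 //; apply: S_mono => //; first by case/andP: s01.
    by case/andP: t01.
  rewrite ler_ln ?posrE ?ltr0n ?S_len //.
  by apply: lt_le_trans (S_ge1 N0 t01).
by rewrite mulrAC (le_trans slope) // (le_trans _ Tb) // gerBl.
Qed.


(** The interval [[p, b]] is cut into three pieces of length [d], and the bound on [S_n] improves
    across each. On [[p1, b]], [log_growth] gives [S_n <= N sqrt n] at [p1]; on [[p2, p1]] this
    makes [theta_n] decay faster than [1/n^2]-summability requires, so [S_n] is bounded at [p2]; on
    [[p, p2]] a bounded [S_n] gives exponential decay. *)
Lemma sharpness : exists a C : R, [/\ 0 < a, 0 < C &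
  forall n, theta n p <= C * expR (- a * n%:R)].
Proof.
clearbody kappa; have [d d0 bE] : exists2 d, 0 < d & b = p + 3 * d.
  by exists ((b - p) / 3); [rewrite divr_gt0 // subr_gt0|field].
have b01 : 0 <= b <= 1 by apply: in01; rewrite lexx ltW.
have [p1 p1E] : exists p1, p1 = p + 2 * d by exists (p + 2 * d).
have [p2 p2E] : exists p2, p2 = p + d by exists (p + d).
have pp2 : p <= p2 by lra.
have p21 : p2 <= p1 by lra.
have p1b : p1 <= b by lra.
have bp1 : b - p1 = d by lra.
have p12 : p1 - p2 = d by lra.
have p2p : p2 - p = d by lra.
have p1in : p <= p1 <= b by rewrite p1b (le_trans pp2).
have p2in : p <= p2 <= b by rewrite pp2 (le_trans p21).
have pin : p <= p <= b by rewrite lexx ltW.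
have [N1 N1_2 HD1] := derivative_bound.
(* Chosen so that [log_growth] over a length [d] bounds [S_n] by a power of [n] with exponent
   [e / (kappa * d) = 1/2]. *)
pose e := kappa * d / 2.
have e0 : 0 < e by rewrite divr_gt0 // mulr_gt0.
have [N2 HN2] := theta_lim_b e0.
pose N := maxn N1 N2.
have N_2 : (2 <= N)%N by rewrite leq_max N1_2.
have N0 : (0 < N)%N by exact: ltnW.
have HD n t : (N <= n)%N -> p <= t <= b ->
    exists D : R, [/\ is_derive t 1 (theta n) D, 0 <= D &
      kappa * n%:R * theta n t <= S n t * D].
  by rewrite geq_max => /andP[/HD1 + _]; apply.
have HN n : (N <= n)%N -> theta n b <= e by rewrite geq_max => /andP[_]; exact: HN2.
have Npos : 0 < N%:R :> R by rewrite ltr0n.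
have Spos n t : (0 < n)%N -> p <= t <= b -> 0 < S n t.
  by move=> n0 /in01 t01; exact: lt_le_trans ltr01 (S_ge1 n0 t01).
(* As [S_n <= B] up to [t], the derivative of [theta_n] is at least [kappa n / B] times [theta_n]
   there, and [growth_expR] applies. *)
have decay n s t B : (N <= n)%N -> p <= s -> s <= t -> t <= b -> S n t <= B -> 0 < B ->
    theta n s <= expR (- (kappa * n%:R / B * (t - s))).
  move=> Nn ps st tb SB B0.
  have tin : p <= t <= b by rewrite (le_trans ps st).
  have n0 := leq_trans N0 Nn.
  apply: (@le_trans _ _ (expR (- (kappa * n%:R / B * (t - s))) * theta n t)); last first.
    by rewrite ler_piMr ?expR_ge0 //; case/andP: (theta01 n (in01 tin)).
  apply: growth_expR => // u /andP[su ut].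
  have uin : p <= u <= b by rewrite (le_trans ps su) (le_trans ut).
  have [D [dD D0 hD]] := HD n u Nn uin; exists D => //.
  rewrite mulrAC ler_pdivrMr // (le_trans hD) // mulrC ler_wpM2l // (le_trans _ SB) //.
  by apply: S_mono => //; [case/andP: (in01 uin)|case/andP: (in01 tin)].
have sqrt_bound n : (N <= n)%N -> S n p1 ^+ 2 <= N%:R ^+ 2 * n%:R.
  move=> Nn; have n0 := leq_trans N0 Nn.
  have npos : 0 < n%:R :> R by rewrite ltr0n.
  have S0 := Spos n p1 n0 p1in.
  have := log_growth N_2 HD HN (ltW e0) p1in Nn; rewrite bp1 => log_le.
  have {}log_le : ln (S n p1) - ln N%:R <= ln n%:R / 2.
    rewrite -(ler_pM2l (mulr_gt0 kappa_gt0 d0)) (le_trans log_le) //.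
    by rewrite /e; lra.
  rewrite -ler_ln ?posrE ?exprn_gt0 ?mulr_gt0 ?exprn_gt0 //.
  have -> : ln (S n p1 ^+ 2) = ln (S n p1) *+ 2 by exact: lnXn.
  have -> : ln (N%:R ^+ 2 * n%:R) = ln N%:R *+ 2 + ln n%:R :> R.
    by rewrite lnM ?posrE ?exprn_gt0 //; congr (_ + _); exact: lnXn.
  rewrite !mulr2n; lra.
(* From [expR x >= (x/4)^4] at [x = kappa n d / S_n], with [256 = 4^4]. Since [S_n <= N sqrt n], [x]
   is of order at least [sqrt n], and the fourth power yields the summable bound [A / n^2]. *)
pose A := 256 * N%:R ^+ 4 / (kappa * d) ^+ 4 : R.
have kd0 : 0 < kappa * d by rewrite mulr_gt0.
have A0 : 0 <= A.
  apply: divr_ge0; last by apply: exprn_ge0; exact: ltW.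
  by apply: mulr_ge0 => //; exact: exprn_ge0.
have poly_decay n : (N <= n)%N -> theta n p2 <= A * (n%:R ^+ 2)^-1.
  move=> Nn; have n0 := leq_trans N0 Nn.
  have npos : 0 < n%:R :> R by rewrite ltr0n.
  have S0 := Spos n p1 n0 p1in.
  have /le_trans := decay n p2 p1 (S n p1) Nn pp2 p21 p1b (lexx _) S0.
  apply; rewrite p12 expRN.
  set x := kappa * n%:R / S n p1 * d.
  have x0 : 0 < x by rewrite /x; apply: mulr_gt0 => //; apply: divr_gt0 => //; exact: mulr_gt0.
  have ex4 : (x / 4) ^+ 4 <= expR x.
    have -> : expR x = expR (x / 4) ^+ 4 by rewrite -expRM_natl; congr expR; field.
    apply: lerXn2r; rewrite ?nnegrE ?expR_ge0 //; first by rewrite divr_ge0 // ltW.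
    by apply: le_trans (expR_ge1Dx _); lra.
  have x4 : 0 < (x / 4) ^+ 4 by rewrite exprn_gt0 // divr_gt0.
  apply: le_trans (_ : ((x / 4) ^+ 4)^-1 <= _); first by rewrite lef_pV2 ?posrE ?expR_gt0.
  have -> : ((x / 4) ^+ 4)^-1 = 256 * (S n p1 ^+ 2) ^+ 2 / ((kappa * d) ^+ 4 * n%:R ^+ 4).
    rewrite /x; field; rewrite !gt_eqF //.
  have -> : A * (n%:R ^+ 2)^-1 =
      256 * (N%:R ^+ 2 * n%:R) ^+ 2 / ((kappa * d) ^+ 4 * n%:R ^+ 4).
    rewrite /A; field; rewrite !gt_eqF //.
  apply: ler_wpM2r.
    by rewrite invr_ge0; apply: mulr_ge0; apply: exprn_ge0 => //; exact: ltW.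
  rewrite ler_wpM2l //; apply: lerXn2r (sqrt_bound n Nn); rewrite nnegrE.
    by apply: exprn_ge0; exact: ltW.
  by apply: mulr_ge0 => //; exact: exprn_ge0.
pose B : R := N%:R + A.
have B0 : 0 < B by rewrite ltr_wpDr.
have S_bounded n : S n p2 <= B.
  have p201 := in01 p2in.
  have H m : S (N + m)%N p2 <= N%:R + A * (N%:R^-1 - (N + m)%:R^-1).
    elim: m => [|m IH]; first by rewrite addn0 subrr mulr0 addr0 S_len.
    rewrite addnS SS; set k := (N + m)%N in IH *.
    have k0 : 0 < k%:R :> R by rewrite ltr0n (leq_trans N0) // leq_addr.
    have kE : k.+1%:R = k%:R + 1 :> R by rewrite natr1.
    have k1 : 0 < k.+1%:R :> R by rewrite ltr0n.
    have telescope : (k.+1%:R ^+ 2)^-1 <= k%:R^-1 - k.+1%:R^-1 :> R.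
      have -> : k%:R^-1 - k.+1%:R^-1 = (k%:R * k.+1%:R)^-1 :> R.
        by rewrite kE in k1 *; field; rewrite !gt_eqF.
      rewrite lef_pV2 ?posrE ?mulr_gt0 // expr2 ler_wpM2r ?(ltW k1) //.
      by rewrite ler_nat.
    have Nk : (N <= k.+1)%N := leq_trans (leq_addr m N) (leqnSn k).
    apply: le_trans (lerD IH (le_trans (poly_decay k.+1 Nk) (ler_wpM2l A0 telescope))) _.
    by rewrite -addrA -mulrDr addrA subrK.
  have [nN|Nn] := leqP n N.
    apply: le_trans (S_len n p201) _; apply: le_trans (_ : N%:R <= _); first by rewrite ler_nat.
    by rewrite lerDl.
  rewrite -(subnKC (ltnW Nn)) (le_trans (H _)) // lerD2l ler_piMr //.
  have : 0 <= (N + (n - N))%:R^-1 :> R by rewrite invr_ge0.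
  have : N%:R^-1 <= 1 :> R by rewrite invf_le1 // ler1n.
  lra.
pose a := kappa * d / B.
(* The constant [expR (a * N)] covers [n < N], where only [theta_n <= 1] is used. *)
have a0 : 0 < a by rewrite divr_gt0 // mulr_gt0.
exists a, (expR (a * N%:R)); split=> //; first exact: expR_gt0.
move=> n; rewrite -expRD; have [Nn|nN] := leqP N n.
  have := decay n p p2 B Nn (lexx p) pp2 (le_trans p21 p1b) (S_bounded n) B0.
  rewrite p2p => /le_trans; apply; rewrite ler_expR /a.
  have -> : kappa * n%:R / B * d = a * n%:R by rewrite /a; lra.
  by rewrite -/a mulNr lerDr mulr_ge0 // ltW.
have /andP[_ /le_trans] := theta01 n (in01 pin); apply.
rewrite -[leLHS]expR0 ler_expR mulNr subr_ge0; apply: ler_wpM2l; first exact: ltW.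
by rewrite ler_nat ltnW.
Qed.

End sharpness.

(** * Random 2-lifts *)

Lemma fset2_inj (K : choiceType) (a b c d : K) : [fset a; b]%fset = [fset c; d]%fset ->
  (a = c /\ b = d) \/ (a = d /\ b = c).
Proof.
move=> /fsetP H.
have: (a == c) || (a == d) by rewrite -in_fset2 -H in_fset2 eqxx.
have: (b == c) || (b == d) by rewrite -in_fset2 -H in_fset2 eqxx orbT.
have: (c == a) || (c == b) by rewrite -in_fset2 H in_fset2 eqxx.
have: (d == a) || (d == b) by rewrite -in_fset2 H in_fset2 eqxx orbT.
move=> /orP[]/eqP dE /orP[]/eqP cE /orP[]/eqP bE /orP[]/eqP aE;
  (left; split; congruence) || (right; split; congruence).
Qed.

Section lift_model.
Context {V : countType} (G : sgraph V).
Local Notation X := (V * bool)%type.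
Local Notation F := (edge (lift_pairs G)).
Local Notation E := (edge G).

Lemma edge_ends (W : countType) (H : sgraph W) (e : edge H) :
  exists uv : W * W, adj H uv.1 uv.2 /\ val e = [fset uv.1; uv.2]%fset.
Proof. by have /asboolP[u [v [? ?]]] := valP e; exists (u, v). Qed.

(** An arbitrary orientation of the edge, obtained by choice. [val_base] and [par_ends] show that
    the base and the parity do not depend on it. *)
Definition ends (W : countType) (H : sgraph W) (e : edge H) : W * W :=
  projT1 (cid (edge_ends e)).

Lemma endsP (W : countType) (H : sgraph W) (e : edge H) :
  adj H (ends e).1 (ends e).2 /\ val e = [fset (ends e).1; (ends e).2]%fset.
Proof. exact: projT2 (cid (edge_ends e)). Qed.

Lemma is_edgeP (W : countType) (H : sgraph W) (u v : W) :
  adj H u v -> is_edge H [fset u; v]%fset.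
Proof. by move=> uv; apply/asboolP; exists u, v. Qed.

Definition mk_edge (W : countType) (H : sgraph W) (u v : W) (uv : adj H u v) : edge H :=
  exist (fun e => is_edge H e) _ (is_edgeP uv).

Lemma ends_eq (W : countType) (H : sgraph W) (e : edge H) u v :
  val e = [fset u; v]%fset ->
  ((ends e).1 = u /\ (ends e).2 = v) \/ ((ends e).1 = v /\ (ends e).2 = u).
Proof. by have [_ ->] := endsP e => /fset2_inj. Qed.

Definition src (f : F) : X := (ends f).1.
Definition dst (f : F) : X := (ends f).2.

Lemma val_ends (f : F) : val f = [fset src f; dst f]%fset.
Proof. by case: (endsP f). Qed.

Lemma adj_ends (f : F) : adj G (src f).1 (dst f).1.
Proof. by case: (endsP f). Qed.

Definition base (f : F) : E := mk_edge (adj_ends f).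

Definition par (f : F) : bool := (src f).2 (+) (dst f).2.

Lemma val_base (f : F) (x y : X) : val f = [fset x; y]%fset ->
  val (base f) = [fset x.1; y.1]%fset.
Proof.
rewrite /base /= /src /dst => /ends_eq[] [-> ->] //; exact: fsetUC.
Qed.

Lemma par_ends (f : F) (x y : X) : val f = [fset x; y]%fset -> par f = x.2 (+) y.2.
Proof. by rewrite /par /src /dst => /ends_eq[] [-> ->] //; exact: addbC. Qed.

Lemma lift_edgesP (eta : E -> bool) (f : F) : lift_edges eta (val f) <-> eta (base f) = par f.
Proof.
split=> [[e [u [v [ve vf]]]]|eta_f].
  have be : base f = e.
    by apply: val_inj; rewrite ve; case: vf => /val_base ->.
  by rewrite be; case: vf => /par_ends -> //=; rewrite ?negbK.
exists (base f), (src f).1, (dst f).1; split => //.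
rewrite eta_f /par val_ends; case: (src f) (dst f) => [u i] [v j] /=.
by case: i; [right; rewrite negbK|left].
Qed.

Lemma open_adjP (w : percolation_config G) x y :
  open_adj w x y <-> joined src dst (open_edges base par w) x y.
Proof.
split=> [/asboolP[f [vf /lift_edgesP lf wf]]|[f /andP[/eqP lf wf] fxy]].
  exists f; first by rewrite /open_edges lf eqxx.
  exact: ends_eq vf.
apply/asboolP; exists f; split => //; last exact/lift_edgesP.
by rewrite val_ends; case: fxy => -[-> ->] //; exact: fsetUC.
Qed.

Definition lifts_seq (e : E) : seq F :=
  let: (u, v) := ends e in
  undup (pmap insub
    [seq [fset (u, i); (v, j)]%fset | i <- [:: false; true], j <- [:: false; true]]).

Definition lifts (e : E) : seq F := [seq f <- lifts_seq e | base f == e].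

Lemma liftsP e f : (f \in lifts e) = (base f == e).
Proof.
rewrite mem_filter; case: eqP => //= be.
rewrite /lifts_seq; case Ee : (ends e) => [u v]; rewrite mem_undup mem_pmap_sub.
have [_ ve] := endsP e; rewrite Ee /= -be in ve.
case/fset2_inj: ve => -[su dv].
  apply/allpairsPdep; exists (src f).2, (dst f).2; split => /=.
  - by case: (src f).2.
  - by case: (dst f).2.
  - by rewrite val_ends -su -dv -!surjective_pairing.
apply/allpairsPdep; exists (dst f).2, (src f).2; split => /=.
- by case: (dst f).2.
- by case: (src f).2.
- by rewrite val_ends -su -dv -!surjective_pairing; exact: fsetUC.
Qed.

Lemma uniq_lifts e : uniq (lifts e).
Proof. by rewrite filter_uniq // /lifts_seq; case: ends => u v; exact: undup_uniq. Qed.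

Lemma size_lifts e : (size (lifts e) <= 4)%N.
Proof.
rewrite size_filter (leq_trans (count_size _ _)) // /lifts_seq; case: ends => u v.
rewrite (leq_trans (size_undup _)) // size_pmap (leq_trans (count_size _ _)) //.
Qed.

Hypothesis G_locally_finite : locally_finite G.

Lemma neighbors_ex u : exists s : seq V, [set y | adj G u y] = [set` s].
Proof. by apply/finite_seqP; exact: G_locally_finite. Qed.

Definition neighbors u : seq V := projT1 (cid (neighbors_ex u)).

Lemma mem_neighbors u v : (v \in neighbors u) = adj G u v.
Proof.
have /seteqP[sub1 sub2] := projT2 (cid (neighbors_ex u)).
by apply/idP/idP; [exact: sub2|exact: sub1].
Qed.

Definition inc (x : X) : seq F :=
  [seq f <- pmap insub [seq [fset x; (v, b)]%fset | v <- neighbors x.1, b <- [:: false; true]]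
  | (src f == x) || (dst f == x)].

Lemma incP x f : (f \in inc x) = (src f == x) || (dst f == x).
Proof.
rewrite mem_filter; case: (boolP (_ || _)) => // fx.
rewrite andTb mem_pmap_sub; apply/allpairsPdep.
have af := adj_ends f.
case/orP: fx => /eqP fx.
  exists (dst f).1, (dst f).2; split => /=.
  - by rewrite -fx mem_neighbors.
  - by case: (dst f).2.
  - by rewrite val_ends -fx -surjective_pairing.
exists (src f).1, (src f).2; split => /=.
- by rewrite -fx mem_neighbors adj_sym.
- by case: (src f).2.
- by rewrite val_ends -fx -surjective_pairing; exact: fsetUC.
Qed.

Lemma open_clusterP (w : percolation_config G) x y :
  open_cluster w x y <-> exists k, y \in reach src dst inc (open_edges base par w) k x.
Proof.
split=> [[s ps <-]|[k]].
  exists (size s); elim: s x ps => [|z s IH] x /=; first by rewrite mem_seq1.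
  by move=> /andP[/open_adjP xz /IH]; exact: (reach_joined incP xz).
elim: k y => [|k IH] y; first by rewrite mem_seq1 => /eqP ->; exists [::].
case/(mem_reachS incP) => [/IH //|[v /IH[s ps lv] vy]].
exists (rcons s y); last by rewrite last_rcons.
by rewrite rcons_path ps lv; apply/open_adjP.
Qed.

Lemma card_open_cluster (w : percolation_config G) x n :
  (`I_n #<= open_cluster w x)%card <-> large src dst inc base par n x w.
Proof.
set O := open_edges base par w; split.
  move=> nA; have [|sub] := reach_stabilizes incP O n x; first by move/ltnW.
  have sub' : open_cluster w x `<=` [set` reach src dst inc O n x].
    by move=> y /open_clusterP[k]; exact: sub.
  have fA : finite_set (open_cluster w x) by apply: sub_finite_set sub' _; exact: finite_seq.
  apply: leq_trans (leq_card_fset_set fA nA) _; apply: uniq_leq_size; first exact: fset_uniq.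
  by move=> y; rewrite in_fset_set // inE => /sub'.
move=> nr; set r := reach src dst inc O n x in nr.
have rA : [set` r] `<=` open_cluster w x by move=> y yr; apply/open_clusterP; exists n.
apply: card_le_trans (subset_card_le rA).
have fr : finite_set [set` r] by exact: finite_seq.
have [m rm] := fr; rewrite (card_le_eqr rm) card_le_II -(card_fset_set rm).
rewrite (leq_trans nr) //; apply: uniq_leq_size; first exact: uniq_reach.
by move=> y yr; rewrite in_fset_set // inE.
Qed.

Lemma infinite_open_cluster (w : percolation_config G) x :
  infinite_set (open_cluster w x) <-> forall n, large src dst inc base par n x w.
Proof.
split=> [/infiniteP h n|h fA].
  apply/card_open_cluster; apply: card_le_trans h; exact: subset_card_le.
have [m Am] := fA; have /card_open_cluster := h m.+1.
by rewrite (card_le_eqr Am) card_le_II ltnn.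
Qed.

(** * Invariance of the averaged law under automorphisms and exchange of levels *)

Section automorphism.
Variables (alpha : V -> V) (c : bool).
Hypothesis alpha_auto : automorphism G alpha.

(** Exchanging the two levels over every vertex at once preserves the parity of each edge, hence
    leaves the twists alone; [c] thus relates [v_0] and [v_1]. *)
Let phi (x : X) : X := (alpha x.1, x.2 (+) c).

Let alpha_adj u v : adj G (alpha u) (alpha v) = adj G u v.
Proof. by case: alpha_auto. Qed.

Let alpha_inj : injective alpha.
Proof. by case: alpha_auto => /bij_inj. Qed.

Let phi_inj : injective phi.
Proof. by move=> [u i] [v j] [/alpha_inj -> /addIb ->]. Qed.

Let phi_surj x : exists y, phi y = x.
Proof.
case: alpha_auto => -[beta _ betaK] _; exists (beta x.1, x.2 (+) c).
by rewrite /phi /= betaK addbK; case: x.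
Qed.

Let edge_map (f : F) : F.
Proof.
refine (@mk_edge _ (lift_pairs G) (phi (src f)) (phi (dst f)) _).
by rewrite /= alpha_adj; exact: adj_ends.
Defined.

Let base_map (e : E) : E.
Proof.
refine (@mk_edge _ G (alpha (ends e).1) (alpha (ends e).2) _).
by rewrite alpha_adj; case: (endsP e).
Defined.

Let relabel (j : E + F) : E + F :=
  match j with inl e => inl (base_map e) | inr f => inr (edge_map f) end.

Let relabel_inj : injective relabel.
Proof.
case=> [e|f] [e'|f'] // [].
  move=> H; congr inl; apply: val_inj.
  have [_ ->] := endsP e; have [_ ->] := endsP e'.
  by case: (fset2_inj H) => -[/alpha_inj -> /alpha_inj ->] //; exact: fsetUC.
move=> H; congr inr; apply: val_inj; rewrite !val_ends.
by case: (fset2_inj H) => -[/phi_inj -> /phi_inj ->] //; exact: fsetUC.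
Qed.

Let base_edge_map f : base (edge_map f) = base_map (base f).
Proof.
apply: val_inj; rewrite (@val_base (edge_map f) (phi (src f)) (phi (dst f))) //=.
have [ve] := endsP (base f); rewrite /= => /fset2_inj[] [<- <-] //; exact: fsetUC.
Qed.

Let par_edge_map f : par (edge_map f) = par f.
Proof.
rewrite (@par_ends (edge_map f) (phi (src f)) (phi (dst f))) //= /par.
by rewrite addbACA addbb addbF.
Qed.

Let open_relabel (w : E + F -> bool) f :
  open_edges base par w (edge_map f) = open_edges base par (w \o relabel) f.
Proof. by rewrite /open_edges base_edge_map par_edge_map. Qed.

Let joined_relabel (w : E + F -> bool) x y :
  joined src dst (open_edges base par w) (phi x) (phi y) <->
  joined src dst (open_edges base par (w \o relabel)) x y.
Proof.
split=> -[f].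
  move=> Of fxy.
  have vf : val f = [fset phi x; phi y]%fset.
    by rewrite val_ends; case: fxy => -[-> ->] //; exact: fsetUC.
  have xy : adj (lift_pairs G) x y.
    rewrite /= -alpha_adj; have := adj_ends f.
    by case: fxy => -[-> ->] //=; rewrite adj_sym.
  pose g : F := mk_edge xy.
  have gxy : (src g = x /\ dst g = y) \/ (src g = y /\ dst g = x) by exact: ends_eq.
  have fg : f = edge_map g.
    by apply: val_inj; rewrite vf /=; case: gxy => -[-> ->] //; exact: fsetUC.
  by exists g => //; rewrite -open_relabel -fg.
move=> Of fxy; exists (edge_map f); first by rewrite open_relabel.
have := @ends_eq _ _ (edge_map f) (phi (src f)) (phi (dst f)) erefl.
rewrite -/(src _) -/(dst _).
by case: fxy => -[<- <-] [] [-> ->]; [left|right|right|left].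
Qed.

Let reach_relabel (w : E + F -> bool) k x z :
  z \in reach src dst inc (open_edges base par w) k (phi x) <->
  exists2 y, y \in reach src dst inc (open_edges base par (w \o relabel)) k x & z = phi y.
Proof.
elim: k z => [|k IH] z.
  rewrite mem_seq1; split=> [/eqP ->|[y]]; first by exists x => //; rewrite mem_seq1.
  by rewrite mem_seq1 => /eqP -> ->.
split.
  case/(mem_reachS incP) => [/IH[y yk ->]|[v /IH[y yk ->]]].
    by exists y => //; apply/(mem_reachS incP); left.
  have [u <-] := phi_surj z => /joined_relabel yu.
  by exists u => //; apply/(mem_reachS incP); right; exists y.
case=> y /(mem_reachS incP)[yk|[v vk vy]] ->; apply/(mem_reachS incP).
  by left; apply/IH; exists y.
by right; exists (phi v); [apply/IH; exists v|apply/joined_relabel].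
Qed.

Let large_relabel k x w :
  large src dst inc base par k (phi x) w = large src dst inc base par k x (w \o relabel).
Proof.
rewrite /large /big; congr (_ <= _)%N; rewrite -[RHS](size_map phi); apply: perm_size.
apply: uniq_perm => [||z]; first exact: uniq_reach.
  by rewrite (map_inj_uniq phi_inj) uniq_reach.
apply/idP/mapP => [/reach_relabel[y yk ->]|[y yk ->]]; first by exists y.
by apply/reach_relabel; exists y.
Qed.

(** [relabel] is injective and preserves the parameters, which only distinguish twists from states.
    The list [s'] need not be the image of [s], so both averages are compared over their
    concatenation. *)
Lemma theta_automorphism (R : realType) k x (t : R) :
  theta src dst inc base par lifts k (alpha x.1, x.2 (+) c) t =
  theta src dst inc base par lifts k x t.
Proof.
rewrite -/(phi x).
pose s := coords lifts (support src dst inc base k x).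
pose s' := coords lifts (support src dst inc base k (phi x)).
pose g (y : X) (w : E + F -> bool) : R := (large src dst inc base par k y w)%:R.
have dep : depends_on s (g x).
  by move=> u u' e; rewrite /g (large_depends par incP liftsP e).
have dep' : depends_on s' (g (phi x)).
  by move=> u u' e; rewrite /g (large_depends par incP liftsP e).
have gphi : g (phi x) = fun w => g x (w \o relabel).
  by apply/funext => w; rewrite /g large_relabel.
have dep'' : depends_on (map relabel s) (g (phi x)).
  rewrite gphi => u u' e; apply: dep => j js /=; apply: e; exact: map_f.
transitivity (Ex (law t) (s' ++ map relabel s) (g (phi x)) (fun=> false)).
  by rewrite (Ex_superset _ dep') // => j js; rewrite mem_cat js.
rewrite (Ex_superset _ dep''); last by move=> j js; rewrite mem_cat js orbT.
rewrite gphi (@Ex_relabel _ _ _ (law t) (law t) relabel) //; last by case.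
Qed.

End automorphism.

End lift_model.

(** * The product measure on events depending on finitely many coordinates *)

Section cylinder_events.
Context {R : realType} {I : countType}.
Variable p : I -> R.
Hypothesis p01 : forall i, 0 <= p i <= 1.
Implicit Types (s J : seq I) (b : I -> bool) (phi : (I -> bool) -> bool).

Let weight b i : R := if b i then p i else 1 - p i.

Let measurable_coord i c : measurable [set w : config I | w i = c].
Proof. by apply: sub_sigma_algebra; exists i, c. Qed.

Let measurable_agree J b : measurable [set w : config I | forall i, i \in J -> w i = b i].
Proof.
elim: J => [|i J IH]; first by rewrite (_ : [set _ | _] = setT) //; apply/seteqP; split.
rewrite (_ : [set _ | _] = [set w : config I | w i = b i] `&`
    [set w : config I | forall i, i \in J -> w i = b i]); first exact: measurableI.
apply/seteqP; split=> w /=.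
  by move=> h; split=> [|j jJ]; apply: h; rewrite inE ?eqxx ?jJ ?orbT.
by move=> [wi h] j; rewrite inE => /predU1P[->//|]; exact: h.
Qed.

(** Coordinates are moved one by one from the averaged list [s] to the prescribed list [J],
    splitting the event by their value; when [s] is empty, [phi] is decided by [b] and
    [bernoulli_productE] applies. *)
Let conditional_cylinder s J b phi : uniq (J ++ s) -> depends_on (J ++ s) phi ->
  let A := [set w : config I | (forall i, i \in J -> w i = b i) /\ phi w] in
  measurable A /\ bernoulli_product p A =
    ((\prod_(i <- J) weight b i) * Ex p s (fun w => (phi w)%:R) b)%:E.
Proof.
elim: s J b => [|i s IH] J b.
  rewrite cats0 => uJ dphi; set A := [set w | _]; rewrite /A.
  have phiE w : (forall i, i \in J -> w i = b i) -> phi w = phi b by exact: dphi.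
  case E : (phi b).
    have -> : [set w : config I | (forall i, i \in J -> w i = b i) /\ phi w] =
        [set w : config I | forall i, i \in J -> w i = b i].
      by apply/seteqP; split=> w /= => [[]//|h]; split => //; rewrite phiE.
    split; first exact: measurable_agree.
    by rewrite [Ex _ _ _ _]/= E mulr1; exact: bernoulli_productE.
  have -> : [set w : config I | (forall i, i \in J -> w i = b i) /\ phi w] = set0.
    by apply/seteqP; split=> w //= [h]; rewrite phiE // E.
  by split => //; rewrite measure0 /= E mulr0.
move=> uJ dphi A.
have perm : perm_eq ((i :: J) ++ s) (J ++ i :: s).
  by rewrite -cat1s -!catA perm_catCA.
have uJ' : uniq ((i :: J) ++ s) by rewrite (perm_uniq perm).
have dphi' : depends_on ((i :: J) ++ s) phi.
  by apply: depends_onW dphi => j; rewrite (perm_mem perm).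
have iJ : i \notin J by move: uJ' => /= /andP[]; rewrite mem_cat negb_or => /andP[].
have H c := IH (i :: J) (upd b i c) uJ' dphi'.
pose B c := [set w : config I | (forall j, j \in i :: J -> w j = upd b i c j) /\ phi w].
have AE : A = B true `|` B false.
  apply/seteqP; split=> w /=.
    move=> [h phw]; case wi : (w i); [left|right]; split => // j; rewrite inE;
      move=> /predU1P[->|jJ]; rewrite ?upd_eq // upd_neq ?h //;
      by apply: contraNneq iJ => <-.
  by case=> -[h phw]; split => // j jJ; rewrite h ?inE ?jJ ?orbT // upd_neq //;
    apply: contraNneq iJ => <-.
have [mT PT] := H true; have [mF PF] := H false.
split; first by rewrite AE; exact: measurableU.
transitivity (bernoulli_product p (B true) + bernoulli_product p (B false))%E.
  rewrite AE; apply: measureU => //.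
  apply/seteqP; split=> w //= -[[h _] [h' _]].
  have := h i (mem_head _ _); rewrite h' ?mem_head //.
  by rewrite !upd_eq.
transitivity ((\prod_(j <- i :: J) weight (upd b i true) j *
    Ex p s (fun w => (phi w)%:R) (upd b i true))%:E +
  (\prod_(j <- i :: J) weight (upd b i false) j *
    Ex p s (fun w => (phi w)%:R) (upd b i false))%:E)%E.
  by congr (_ + _)%E.
rewrite -EFinD; congr EFin.
rewrite /= /avg !big_cons.
have prodE c : \prod_(j <- J) weight (upd b i c) j = \prod_(j <- J) weight b j.
  rewrite !big_seq; apply: eq_bigr => j jJ; rewrite /weight upd_neq //.
  by apply: contraNneq iJ => <-.
by rewrite !prodE /weight !upd_eq; ring.
Qed.

Lemma measurable_cylinder s phi : depends_on s phi ->
  measurable [set w : config I | phi w].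
Proof.
move=> dphi.
have [|| m _] := @conditional_cylinder (undup s) [::] (fun=> false) phi.
- exact: undup_uniq.
- by apply: depends_onW dphi => i; rewrite mem_undup.
rewrite (_ : [set _ | _] =
  [set w : config I | (forall i, i \in [::] -> w i = false) /\ phi w]) //.
by apply/seteqP; split=> w //= [].
Qed.

Lemma bernoulli_product_cylinder s phi : depends_on s phi ->
  bernoulli_product p [set w : config I | phi w] =
  (Ex p s (fun w => (phi w)%:R) (fun=> false))%:E.
Proof.
move=> dphi.
have [|| _] := @conditional_cylinder (undup s) [::] (fun=> false) phi.
- exact: undup_uniq.
- by apply: depends_onW dphi => i; rewrite mem_undup.
rewrite big_nil mul1r Ex_undup => <-; congr (bernoulli_product p _).
by apply/seteqP; split=> w //= [].
Qed.

End cylinder_events.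

(** * From the percolation measure to [theta] *)

Section random_lift.
Context {R : realType} {V : countType} (G : sgraph V).
Hypothesis G_locally_finite : locally_finite G.
Variable o : V * bool.
Local Notation Inc := (inc G_locally_finite).
Local Notation Large := (large (@src V G) (@dst V G) Inc (@base V G) (@par V G)).
Local Notation Theta := (theta (@src V G) (@dst V G) Inc (@base V G) (@par V G) (@lifts V G)).

Let dep n x : depends_on
  (coords (@lifts V G) (support (@src V G) (@dst V G) Inc (@base V G) n x)) (Large n x).
Proof. exact: (large_depends (@par V G) (@incP V G G_locally_finite) (@liftsP V G)). Qed.

Lemma measurable_large n x : measurable [set w : percolation_config G | Large n x w].
Proof.
apply: (@measurable_cylinder R _ (fun=> 0) _ _ _ (@dep n x)).
by move=> i; rewrite lexx ler01.
Qed.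

Lemma percolation_large n x (t : R) : 0 <= t <= 1 ->
  percolation G t (1 / 2) [set w : percolation_config G | Large n x w] = (Theta n x t)%:E.
Proof.
move=> t01; rewrite /percolation /theta -(bernoulli_product_cylinder _ (@dep n x)) //.
exact: law01.
Qed.

(** The events [large n o] decrease to the event that the cluster of [o] is infinite, which is null
    because [Psi] vanishes; continuity from above concludes. *)
Lemma theta_cvg0 (t : R) : 0 <= t <= 1 -> Psi G t (1 / 2) = 0%E ->
  forall e : R, 0 < e -> exists N, forall n, (N <= n)%N -> Theta n o t <= e.
Proof.
move=> t01 Psi0 e e0; pose A n := [set w : percolation_config G | Large n o w].
have mA n : measurable (A n) by exact: measurable_large.
pose Inf x := \bigcap_n [set w : percolation_config G | Large n x w].
have InfE x : [set w | infinite_set (open_cluster w x)] = Inf x.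
  apply/seteqP; split=> w /=.
    by move=> /(infinite_open_cluster G_locally_finite) h n _; exact: h.
  by move=> h; apply/(infinite_open_cluster G_locally_finite) => n; exact: h.
have mInf x : measurable (Inf x).
  by apply: bigcap_measurable => [|n _]; [exists 0%N|exact: measurable_large].
have PInf : percolation G t (1 / 2) (Inf o) = 0%E.
  apply/eqP; rewrite eq_le measure_ge0 andbT -Psi0 /Psi.
  (* A countable union over the codes of vertices, which shows that the event in [Psi] is
     measurable. *)
  have -> : [set w | exists x, infinite_set (open_cluster w x)] =
      \bigcup_n (if choice.unpickle n is Some x then Inf x else set0).
    apply/seteqP; split=> w /=.
      move=> [x]; rewrite -[infinite_set _]/([set w | infinite_set (open_cluster w x)] w) InfE.
      by exists (choice.pickle x) => //; rewrite choice.pickleK.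
    move=> [n _]; case: choice.unpickle => [x|//].
    by rewrite -InfE => h; exists x.
  apply: le_measure; rewrite ?inE //.
    by apply: bigcup_measurable => n _; case: choice.unpickle.
  by move=> w Iw; exists (choice.pickle o) => //; rewrite choice.pickleK.
have cvg0 : percolation G t (1 / 2) (A n) @[n --> \oo] --> 0%E.
  rewrite -PInf; apply: nonincreasing_cvg_mu => //.
  - by rewrite (le_lt_trans (probability_le1 _ _)) // ltry.
  - exact: mInf.
  - move=> n m nm; apply/subsetPset => w.
    exact: (@bigW _ _ _ _ _ (@incP V G G_locally_finite) _ _ _ _ nm).
have {}cvg0 : Theta n o t @[n --> \oo] --> (0 : R).
  move: cvg0; under eq_fun do rewrite percolation_large //.
  by move/fine_cvgP => [].
have /cvgr0_norm_le /(_ _ e0) [N _ HN] := cvg0.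
by exists N => n Nn; apply: le_trans (ler_norm _) (HN n Nn).
Qed.

End random_lift.

Theorem theorem1p4 (R : realType) (V : countType) (G : sgraph V)
  (G_connected : connected_graph G) (G_locally_finite : locally_finite G)
  (G_infinite : infinite_set [set: V]) (G_transitive : vertex_transitive G)
  (p : R) (p01 : 0 <= p <= 1) (p_lt_pc : p < p_c G (1 / 2))
  (o : V * bool) :
  exists c C : R, [/\ 0 < c, 0 < C & forall n : nat,
    (percolation G p (1 / 2)
       [set w : percolation_config G | (`I_n #<= open_cluster w o)%card]
       <= (C * expR (- c * n%:R))%:E)%E].
Proof.
have [p0 p1] := andP p01.
(* The supremum of the empty set is 0 by convention, so [0 <= p < p_c] forces the set defining [p_c]
   to be nonempty. *)
have [b [b01 Psi_b] pb] : exists2 b : R, 0 <= b <= 1 /\ Psi G b (1 / 2) = 0%E & p < b.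
  have lt := p_lt_pc; apply: sup_gt lt; apply/set0P/eqP => S0.
  by move: p_lt_pc; rewrite /p_c S0 sup0 ltNge p0.
have [b0 b1] := andP b01.
pose incG := inc G_locally_finite; pose incGP := incP G_locally_finite.
pose th : nat -> V * bool -> R -> R :=
  theta (@src V G) (@dst V G) incG (@base V G) (@par V G) (@lifts V G).
have th_hom k x (t : R) : th k x t = th k o t.
  (* Transitivity of [G] moves [o.1] to [x.1], and the exchange of levels by [o.2 (+) x.2] corrects
     the second coordinate. *)
  have [alpha aut ox] := G_transitive o.1 x.1.
  rewrite /th -(theta_automorphism G_locally_finite (o.2 (+) x.2) aut k o t) ox addKb.
  by rewrite -surjective_pairing.
have law_in01 (t : R) : 0 <= t <= 1 ->
    forall j : edge G + edge (lift_pairs G), 0 <= law t j <= 1.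
  exact: law01.
have th01 n (t : R) : 0 <= t <= 1 -> 0 <= th n o t <= 1.
  move=> /law_in01 l01; rewrite Ex_ge0 //= Ex_le1 // => w.
  by case: large.
have th1 (t : R) : 0 <= t <= 1 -> th 1%N o t = 1.
  move=> t01; rewrite /th /theta -[RHS](Ex_cst (law t) (coords (@lifts V G)
    (support (@src V G) (@dst V G) incG (@base V G) 1 o)) 1 (fun=> false)).
  congr (Ex _ _ _ _); apply/funext => w.
  by rewrite /large (@big_reach _ _ _ _ _ incGP _ _ 0).
have th_dec n (t : R) : 0 <= t <= 1 -> th n.+1 o t <= th n o t.
  move=> t01; pose l := support (@src V G) (@dst V G) incG (@base V G) n.+1 o ++
    support (@src V G) (@dst V G) incG (@base V G) n o.
  have thE k : {subset support (@src V G) (@dst V G) incG (@base V G) k o <= l} ->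
      th k o t = Ex (law t) (coords (@lifts V G) l)
        (fun w => (large (@src V G) (@dst V G) incG (@base V G) (@par V G) k o w)%:R) (fun=> false).
    by move=> kl; rewrite /th (thetaE _ incGP (@liftsP V G) _ _ kl).
  rewrite !thE; [|by move=> e el; rewrite mem_cat el ?orbT..].
  apply: ler_Ex => [|w]; first exact: law_in01.
  rewrite ler_nat; case: (boolP (large _ _ _ _ _ n.+1 _ _)) => //.
  by move=> /(bigW incGP (leqnSn n)) h; rewrite lt0b; exact: h.
have ineq n (t : R) : (0 < n)%N -> 0 <= t <= 1 ->
    let m := n%:R^-1 * \sum_(1 <= k < n.+1) th k o t in
    exists D : R, [/\ is_derive t 1 (th n o) D, 0 <= D &
      (1 - t) ^+ 4 * (th n o t * (1 / 2 - m)) <= 24 * m * D].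
  move=> n0 t01.
  exact: (theta_ghost_inequality incGP (@liftsP V G) (@uniq_lifts V G) (@size_lifts V G)
    th_hom n0 t01).
(* [b] may be 1, where [(1 - t)^4] vanishes. The inequality is therefore integrated only up to the
   midpoint, while the convergence to 0 is known at [b]. *)
have pm : p < (p + b) / 2 by lra.
have mb : (p + b) / 2 <= b by lra.
have m1 : (p + b) / 2 < 1 by lra.
have [a [C [a0 C0 decay]]] :=
  @sharpness _ (fun n => th n o) _ _ _ p0 pm m1 mb b1 th01 th1 th_dec ineq
    (@theta_cvg0 _ _ _ G_locally_finite o _ b01 Psi_b).
exists a, C; split => // n.
rewrite (_ : [set w | _] = [set w : percolation_config G |
    large (@src V G) (@dst V G) incG (@base V G) (@par V G) n o w]); last first.
  by apply/seteqP; split=> w /(card_open_cluster G_locally_finite).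
by rewrite percolation_large // lee_fin; exact: decay.
Qed.
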